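(* Let $p$ be a prime with $p \geq 11$ and let $m$ be a positive integer all of whose prime divisors are at least $5$ (the case $m=1$ being included). Then $$\sigma(PSL(2,p) \wr C_{m}) = \alpha(m) + (p+1)^{m} + \left(\frac{p(p-1)}{2}\right)^{m}.$$
   Context: For a non-cyclic finite group $X$, $\sigma(X)$ denotes the least number of proper subgroups of $X$ whose union is $X$. $\alpha(m)$ is the number of distinct prime divisors of $m$ (so $\alpha(1)=0$). $PSL(2,p)$ is the projective special linear group of dimension $2$ over the field of order $p$. $C_m$ is the cyclic group of order $m$, and $S \wr C_m$ is the wreath product $S^m \rtimes C_m$ in which a generator of $C_m$ permutes the $m$ coordinates cyclically. *)

(* Defs.v *)
From HB Require Import structures.
From mathcomp Require Import all_boot all_order all_algebra all_fingroup all_solvable.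

Set Implicit Arguments.
Unset Strict Implicit.
Unset Printing Implicit Defensive.

Import GroupScope GRing.Theory.

HB.instance Definition _ := SemiGroup.isComLaw.Build nat minn minnA minnC.

Section CoveringNumber.

Variable gT : finGroupType.
Implicit Types (G H : {group gT}) (C : {set {group gT}}).

Definition subgroup_cover G C : bool :=
  [forall H in C, H \proper G] && (\bigcup_(H in C) (H : {set gT}) == G).

(* The initial value of the minimum bounds the size of every family of
   subgroups, so it does not affect the result once a cover exists. The value 0
   on cyclic groups, which have no cover, is conventional. *)
Definition sigma G : nat :=
  if cyclic G then 0
  else \big[minn/#|{: {group gT}}|]_(C | subgroup_cover G C) #|C|.

Lemma sigma_min G C : subgroup_cover G C -> sigma G <= #|C|.
Proof.
move=> covC; rewrite /sigma; case: ifP => // _.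
by rewrite (bigD1 C) //= geq_minl.
Qed.

Lemma sigma_attained G :
  ~~ cyclic G -> exists2 C, subgroup_cover G C & #|C| = sigma G.
Proof.
move=> ncG.
have cov0 : subgroup_cover G [set H : {group gT} | H \proper G].
  apply/andP; split; first by apply/forall_inP => H; rewrite inE.
  rewrite eqEsubset; apply/andP; split.
    by apply/bigcupsP => H; rewrite inE => /proper_sub.
  apply/subsetP => x Gx; apply/bigcupP; exists <[x]>%G; last exact: cycle_id.
  rewrite inE properEneq cycle_subG Gx andbT; apply: contraNneq ncG => <-.
  exact: cycle_cyclic.
rewrite /sigma (negPf ncG).
case: (arg_minnP (fun C : {set {group gT}} => #|C|) cov0) => C covC minC.
exists C => //; apply/eqP; rewrite eqn_leq; apply/andP; split; last first.
  by rewrite (bigD1 C) //= geq_minl.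
elim/big_ind: _ => [|a b Ca Cb|//]; first exact: max_card.
by rewrite leq_min Ca.
Qed.

End CoveringNumber.

Section SpecialLinear.

Variables (n : nat) (R : finComUnitRingType).

Definition SL : {set {'GL_n[R]}} := [set u | (\det (GLval u) == 1)%R].

Lemma SL_group_set : group_set SL.
Proof.
apply/group_setP; split=> [|u v]; rewrite !inE; first by rewrite GL_1E det1.
by rewrite GL_ME det_mulmx => /eqP-> /eqP->; rewrite mulr1.
Qed.
Canonical SL_group := Group SL_group_set.

(* coset_of 'Z(SL) also contains the cosets of elements of 'N('Z(SL)) outside SL,
   so PSL is a subgroup of this type; its own finGroupType is [subg PSL_group]. *)
Definition PSL : {set coset_of 'Z(SL)} := SL / 'Z(SL).
Canonical PSL_group := [group of PSL].

End SpecialLinear.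

Section CyclicWreath.

Variables (gT : finGroupType) (m : nat).

(* The constant family is written applied to i so that the library's n-ary
   direct product group structure is inferred. *)
Definition power_group : finGroupType := {dffun forall i : 'I_m, (fun=> gT) i}.

(* The inverse makes this a right action, as the library requires. *)
Definition coord_perm (f : power_group) (s : 'S_m) : power_group :=
  [ffun i => f (s^-1 i)].

Lemma coord_perm1 : coord_perm^~ 1 =1 id.
Proof. by move=> f; apply/ffunP => i; rewrite ffunE invg1 perm1. Qed.

Lemma coord_permM f : act_morph coord_perm f.
Proof. by move=> s t; apply/ffunP => i; rewrite !ffunE invMg permM. Qed.

Canonical coord_perm_action := TotalAction coord_perm1 coord_permM.

Lemma coord_perm_is_groupAction : is_groupAction setT coord_perm_action.
Proof.
move=> s _; rewrite inE; apply/andP; split; first by apply/subsetP => f; rewrite inE.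
by apply/morphicP => f g _ _; rewrite !actpermE; apply/ffunP => i; rewrite !ffunE.
Qed.
Canonical coord_perm_groupAction := GroupAction coord_perm_is_groupAction.

Definition cyc_shift : 'S_m := perm (@ordS_inj m).

Definition cyc_wreath : finGroupType :=
  sdprod_by (coord_perm_groupAction \ subsetT <[cyc_shift]>%g)%gact.

Lemma order_cyc_shift : 0 < m -> #[cyc_shift] = m.
Proof.
move=> m_gt0.
have shiftX k (i : 'I_m) : (cyc_shift ^+ k) i = (i + k) %% m :> nat.
  elim: k => [|k IHk]; first by rewrite expg0 perm1 addn0 modn_small.
  by rewrite expgSr permM permE /= IHk -addn1 modnDml addn1 addnS.
apply/eqP; rewrite eqn_dvd order_dvdn; apply/andP; split.
  by apply/eqP/permP => i; apply: ord_inj; rewrite shiftX perm1 modnDr modn_small.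
have := shiftX #[cyc_shift] (Ordinal m_gt0).
by rewrite expg_order perm1 /= add0n /dvdn => <-.
Qed.

End CyclicWreath.

(* Main.v *)
Require Import Defs.
From mathcomp Require Import all_boot all_order all_algebra all_fingroup all_solvable.
From mathcomp Require Import zify ring.

Set Implicit Arguments.
Unset Strict Implicit.
Unset Printing Implicit Defensive.

Import GroupScope.

(** Write S = PSL(2, p) and let U and T be the images in S of the unipotent
    subgroup and of a nonsplit torus of SL(2, p). Both are cyclic, of orders p
    and (p + 1) / 2, with p + 1 and p (p - 1) / 2 conjugates. They govern the
    covers of S for three reasons. Every element of S normalizes a conjugate of
    U or of T, according to whether it has an eigenvector over F_p
    ([im_cover]). A proper subgroup of S that contains U or T normalizes it
    ([im_unip_over], [im_torus_over]): for U because two distinct Sylow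
    p-subgroups generate S, for T by Dickson's class equation for subgroups
    without elements of order p, which needs (p + 1) / 2 >= 6. And a generator
    of one of these conjugates normalizes no other one (orders, and
    [im_unip_isolated], [im_torus_isolated]). So, for m = 1, the normalizers
    cover S, and each of them is the only maximal subgroup that contains the
    generators of its conjugate.

    For the wreath product G, let c generate the cyclic group on top and call a
    tuple any choice, for each of the m coordinates, of a conjugate of U, or
    for each of a conjugate of T. There are (p + 1) ^ m + (p (p - 1) / 2) ^ m
    tuples. An element g of G over a generator of <c> permutes the coordinates
    in one cycle, and it stabilizes a tuple as soon as one coordinate of g ^ m
    normalizes a conjugate of U or T. Hence the stabilizers of tuples, with the
    alpha(m) normal subgroups of prime index over <c ^ r>, cover G
    ([sigma_cyc_wreath_le]).

    For the lower bound, look at the elements g over c such that g ^ m has a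
    coordinate that generates a conjugate of U or T. Each of them stabilizes
    exactly one tuple. A proper subgroup H that meets the coset over c has
    conjugate projections to the coordinates. If they are proper in S, then H
    stabilizes the tuple of each such g that it contains. If they are all of S,
    then, S being simple, the base part of H is a product of diagonals over
    blocks of t > 1 coordinates with t dividing m, so t >= 5 and H has at most
    |S| ^ (m / 5) elements over c ([subdirect_bound]), no more than there are
    elements attached to one tuple. So a cover has at least as many members that
    meet the coset over c as there are tuples ([card_supplements]).

    Finally, let r be a prime divisor of m. Either the cover has a member that
    contains an element over c ^ r and none over c, and these members differ for
    different r; or all elements over c ^ r lie in members that meet the coset
    over c. In the second case consider the elements over c ^ r whose power
    m / r generates a conjugate of U in one coordinate and one of T in another:
    among those members only the ones of diagonal type can contain them, and
    these are so small that too many of them would be needed ([cover_large]). *)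

(** * Elements of the cyclic wreath product *)

Section WreathElements.

Variables (gT : finGroupType) (m : nat).
Local Notation W := (cyc_wreath gT m).
Local Notation c := (cyc_shift m).
Implicit Types (g h : W) (s t : 'S_m) (k : 'I_m).

Definition top g : 'S_m := g.1.
Definition bot g k : gT := g.2 k.

Lemma top_in g : top g \in <[c]>.
Proof. by case: g => -[s f] /[dup] /setXP[]. Qed.

Lemma topM : {morph top : g h / g * h}.
Proof. by []. Qed.

Lemma botM g h k : bot (g * h) k = bot g ((top h)^-1 k) * bot h k.
Proof.
rewrite /bot /= ffunE /=; congr (_ * _).
by rewrite /ract /= /coord_perm ffunE.
Qed.

Lemma topbot_inj g h : top g = top h -> bot g =1 bot h -> g = h.
Proof.
case: g h => -[s f] /= Hg [[t e] /= Hh]; rewrite /top /bot /= => est efe.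
by apply: val_inj => /=; congr pair => //; apply/ffunP.
Qed.

Definition wreath_elt s (f : 'I_m -> gT) : W :=
  insubd (1 : W) (s, finfun f : power_group gT m).

Lemma wreath_eltE s f : s \in <[c]> -> top (wreath_elt s f) = s /\ bot (wreath_elt s f) =1 f.
Proof.
move=> sc; have E : val (wreath_elt s f) = (s, finfun f : power_group gT m).
  by rewrite /wreath_elt val_insubd !inE sc.
rewrite /top /bot; split=> [|k]; move/(congr1 fst): (E);
  by move/(congr1 snd): (E) => //= -> _; rewrite ffunE.
Qed.

End WreathElements.

(** * The cyclic shift *)

Section ShiftCycle.

Variable m : nat.
Local Notation c := (cyc_shift m).
Implicit Types (s : 'S_m) (i j k : 'I_m).

Lemma cyc_shiftX n k : (c ^+ n) k = (k + n) %% m :> nat.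
Proof.
elim: n => [|n IHn]; first by rewrite expg0 perm1 addn0 modn_small.
by rewrite expgSr permM permE /= IHn -addn1 modnDml addn1 addnS.
Qed.

Lemma cyc_shift_trans i j : exists n, (c ^+ n) i = j.
Proof.
have m_gt0 : 0 < m by apply: leq_trans (ltn_ord i).
exists (j + (m - i)); apply: ord_inj.
have := ltn_ord i; have := ltn_ord j => ltj lti.
rewrite cyc_shiftX (_ : i + (j + (m - i)) = j + m); last by lia.
by rewrite modnDr modn_small.
Qed.

(** Powers of the shift commute and permute the indices transitively, so one that
    fixes an index fixes them all. *)
Lemma cycle_shift_free s k : s \in <[c]> -> s k = k -> s = 1.
Proof.
move=> /cycleP[n ->] fixk; apply/permP => i; rewrite perm1.
have [l <-] := cyc_shift_trans k i.
by rewrite -permM -expgD addnC expgD permM fixk.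
Qed.

Lemma gen_shift_trans s i j : <[s]> = <[c]> -> exists n, (s ^+ n) i = j.
Proof.
move=> gen; have [n <-] := cyc_shift_trans i j.
have /cycleP[l ->] : c ^+ n \in <[s]> by rewrite gen mem_cycle.
by exists l.
Qed.

End ShiftCycle.

(** * The base group and its coordinates *)

Section WreathSubgroups.

Variables (gT : finGroupType) (m : nat).
Local Notation W := (cyc_wreath gT m).
Local Notation c := (cyc_shift m).
Implicit Types (g h x y : W) (s t : 'S_m) (i j k : 'I_m) (H : {group W}).

Canonical top_morphism := @Morphism W _ setT (@top gT m) (in2W (@topM gT m)).

Definition base : {group W} := [group of 'ker (@top gT m)].

Lemma baseP x : reflect (top x = 1) (x \in base).
Proof. by apply: (@kerP _ _ _ top_morphism); rewrite inE. Qed.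

Lemma topX g n : top (g ^+ n) = top g ^+ n.
Proof. by apply: (morphX top_morphism); rewrite inE. Qed.

Lemma topV g : top g^-1 = (top g)^-1.
Proof. by apply: (morphV top_morphism); rewrite inE. Qed.

Lemma bot1 k : bot (1 : W) k = 1.
Proof. by rewrite /bot /= ffunE. Qed.

Lemma baseJ g x : x \in base -> x ^ g \in base.
Proof.
by move=> /baseP tx; apply/baseP; rewrite /conjg !topM tx mul1g topV mulVg.
Qed.

Lemma botJ g x k : x \in base -> bot (x ^ g) k = bot x ((top g)^-1 k) ^ bot g k.
Proof.
move=> Bx; have := botM g (x ^ g) k; rewrite -conjgC botM.
rewrite (baseP _ (baseJ g Bx)) invg1 perm1.
by move=> E; apply: (mulgI (bot g k)); rewrite -[RHS]conjgC -E.
Qed.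

Lemma bot_morphM k : {in base &, {morph (fun x => bot x k) : x y / x * y}}.
Proof. by move=> x y Bx /baseP ty; rewrite botM ty invg1 perm1. Qed.
(** [bot] again, with the index first, so that on [base] it is a morphism. *)
Definition coord k : W -> gT := fun x => bot x k.
Canonical coord_morphism k := @Morphism W gT base (coord k) (@bot_morphM k).

Lemma bot_div k x y : x \in base -> y \in base ->
  bot (x * y^-1) k = bot x k * (bot y k)^-1.
Proof.
move=> Bx By; rewrite (bot_morphM k) ?groupV //; congr (_ * _).
exact: (morphV (coord_morphism k) By).
Qed.

(** Conjugation by [g] moves coordinate [k] to [top g k], so the projections of a
    subgroup that meets the coset over the shift are all conjugate. *)
Lemma coord_im_conj H g k : g \in H ->
  coord (top g k) @* H = (coord k @* H) :^ bot g (top g k).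
Proof.
move=> Hg; apply/eqP; rewrite eqEsubset; apply/andP; split; apply/subsetP => z.
  case/morphimP => x Bx Hx ->.
  rewrite mem_conjg; apply/morphimP; exists (x ^ g^-1).
  - exact: baseJ.
  - by rewrite groupJ ?groupV.
  have := botJ g (top g k) (baseJ g^-1 Bx).
  by rewrite conjgKV permK /= /coord => ->; rewrite conjgK.
rewrite mem_conjg => /morphimP[x Bx Hx xz].
have -> : z = coord (top g k) (x ^ g).
  by rewrite /coord botJ // permK -[bot x k]xz conjgKV.
by apply: mem_morphim; rewrite ?baseJ // groupJ.
Qed.

Lemma botX_shift g n l k :
  bot (g ^+ (n + l)) k = bot (g ^+ n) ((top g ^+ l)^-1 k) * bot (g ^+ l) k.
Proof. by rewrite expgD botM topX. Qed.

Lemma card_base : #|base| = (#|gT| ^ m)%N.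
Proof.
rewrite -[RHS](_ : #|{ffun 'I_m -> gT}| = _); last by rewrite card_ffun card_ord.
rewrite -cardsT -(@card_in_imset _ _ (fun x : W => [ffun k => bot x k]) base).
  congr #|pred_of_set _|; apply/setP => f; rewrite !inE; apply/imsetP.
  have [t b] := wreath_eltE f (group1 <[c]>).
  exists (wreath_elt 1 f); first by apply/baseP.
  by apply/ffunP => k; rewrite ffunE b.
move=> x y /baseP tx /baseP ty /ffunP E.
apply: topbot_inj => [|k]; first by rewrite tx ty.
by have := E k; rewrite !ffunE.
Qed.

(** Counting the elements of a subgroup over a given permutation amounts to
    counting its base part. *)
Lemma top_fiber H g : g \in H ->
  [set x in H | top x == top g] = (H :&: base) :* g.
Proof.
move=> Hg; apply/setP => x; rewrite mem_rcoset in_setI inE groupMr ?groupV //.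
congr (_ && _); apply/eqP/baseP => [tx|]; first by rewrite topM topV tx mulgV.
by rewrite topM topV => /eqP; rewrite -eq_mulgV1 => /eqP.
Qed.

End WreathSubgroups.

(** * Subgroups whose base part is subdirect *)

Section Subdirect.

Variables (gT : finGroupType) (m : nat) (H : {group cyc_wreath gT m}).
Local Notation W := (cyc_wreath gT m).
Local Notation c := (cyc_shift m).
Hypotheses (simpleS : simple [set: gT]) (nabS : ~~ abelian [set: gT]).
Hypothesis fullH : forall k, coord k @* H = [set: gT].
Implicit Types (g h x y : W) (i j k : 'I_m).

Lemma derived_setT : [~: [set: gT], [set: gT]] = [set: gT].
Proof.
have [_ simp] := simpleP _ simpleS.
case: (simp [~: [set: gT], [set: gT]]%G (der_normal 1 _)) => //= eq1.
by case/negP: nabS; rewrite /abelian; apply/commG1P.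
Qed.

(** [killed i] and [killed j] coincide exactly when coordinates [i] and [j] of the
    base part of [H] determine each other, that is, lie in the same diagonal. *)
Definition killed k : {group W} := [group of (H :&: base gT m) :&: 'ker (coord k)].

Lemma killedP k x :
  reflect [/\ x \in H, x \in base gT m & bot x k = 1] (x \in killed k).
Proof.
apply: (iffP idP) => [/setIP[/setIP[Hx Bx] /mker kx] // | [Hx Bx kx]].
by apply/setIP; split; [apply/setIP | apply/kerP].
Qed.

Lemma killed_normal k : killed k <| H :&: base gT m.
Proof.
have n1 : 'ker (coord k) <| base gT m := ker_normal (coord_morphism gT k).
by apply: normalGI (subsetIr _ _) n1.
Qed.

Lemma coord_imI k : coord k @* (H :&: base gT m) = [set: gT].
Proof. by rewrite setIC morphimIdom fullH. Qed.

Lemma card_killed k : (#|killed k| * #|gT|)%N = #|H :&: base gT m|.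
Proof.
rewrite -[#|gT|]cardsT -(coord_imI k) card_morphim /= (setIidPr (subsetIr _ _)).
exact: LagrangeI.
Qed.

(** Goursat's alternative: the projection of [killed i] to coordinate [j] is
    normal in a simple group. If it were trivial, [killed i] would lie in
    [killed j], and the two have the same order. *)
Lemma killed_full i j : killed i != killed j -> coord j @* killed i = [set: gT].
Proof.
move=> neq; have [_ simp] := simpleP _ simpleS.
have nk : coord j @* killed i <| [set: gT].
  by rewrite -(coord_imI j); apply: morphim_normal (killed_normal i).
case: (simp _ nk) => //= im1; case/negP: neq.
rewrite -val_eqE eqEcard /=; apply/andP; split; last first.
  have [] := (card_killed i, card_killed j) => <- /eqP.
  by rewrite eqn_pmul2r ?cardG_gt0 -?cardsT ?cardG_gt0 // => /eqP ->.
apply/subsetP => x kx; have /killedP[Hx Bx _] := kx.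
apply/killedP; split=> //.
have : coord j x \in coord j @* killed i by apply: mem_morphim.
by rewrite im1 => /set1P.
Qed.

Definition killed_seq (s : seq 'I_m) : {group W} :=
  foldr (fun k (L : {group W}) => L :&: killed k)%G (H :&: base gT m)%G s.

Lemma killed_seq_normal s : killed_seq s <| H :&: base gT m.
Proof.
elim: s => [|k s IHs]; first exact: normal_refl.
have sub := normal_sub IHs; rewrite /normal /=.
rewrite (subset_trans (subsetIl _ _) sub) normsI ?normal_norm //.
exact: killed_normal.
Qed.

Lemma killed_seqP s x :
  x \in killed_seq s -> [/\ x \in H, x \in base gT m & {in s, forall k, bot x k = 1}].
Proof.
elim: s => [/setIP[] | k s IHs /setIP[/IHs[Hx Bx sx] /killedP[_ _ kx]]] //.
by split=> // l; rewrite inE => /predU1P[-> | /sx].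
Qed.

(** Coordinate [i] stays full when one more coordinate [k] is killed: the
    commutator of the two normal subgroups lies in their intersection, and
    projects onto the commutator subgroup of a perfect group. *)
Lemma killed_seq_full s i :
  {in s, forall j, killed j != killed i} -> coord i @* killed_seq s = [set: gT].
Proof.
elim: s => [|k s IHs] neq; first exact: coord_imI.
have fs := IHs (fun j sj => neq j (mem_behead (s := k :: s) sj)).
have fk := killed_full (neq k (mem_head k s)).
have nk := killed_normal k; have ns := killed_seq_normal s.
apply/eqP; rewrite -subTset -derived_setT -{1}fs -fk -morphimR; last 2 first.
- by apply: subset_trans (normal_sub ns) (subsetIr _ _).
- by apply: subset_trans (normal_sub nk) (subsetIr _ _).
apply: morphimS; rewrite subsetI commg_subl commg_subr.
rewrite (subset_trans (normal_sub nk) (normal_norm ns)).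
by rewrite (subset_trans (normal_sub ns) (normal_norm nk)).
Qed.

(** When no two coordinates are tied, killing all but one of them shows that [H]
    contains elements with an arbitrary single coordinate; these correct any
    base element one coordinate at a time. *)
Lemma killed_inj_full : injective killed -> base gT m \subset H.
Proof.
move=> inj; apply/subsetP => x Bx.
suff agree (s : seq 'I_m) : exists2 y, y \in H :&: base gT m & {in s, forall k, bot y k = bot x k}.
  have [y /setIP[Hy /baseP ty] yx] := agree (enum 'I_m).
  rewrite (_ : x = y) //; apply: topbot_inj => [|k]; first by rewrite ty; apply/baseP.
  by rewrite yx ?mem_enum.
elim: s => [|k s [y Ky yx]]; first by exists 1.
have [ks | ks] := boolP (k \in s).
  by exists y => // l; rewrite inE => /predU1P[-> | ]; apply: yx.
have full : coord k @* killed_seq s = [set: gT].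
  apply: killed_seq_full => j sj; apply: contraNneq ks => /inj <- //.
have : (bot y k)^-1 * bot x k \in coord k @* killed_seq s by rewrite full inE.
case/morphimP => z Bz /killed_seqP[Hz _ sz] /esym zk.
exists (y * z); first by rewrite groupM // in_setI Hz.
have bM l : bot (y * z) l = bot y l * bot z l.
  by apply: (bot_morphM l) => //; case/setIP: Ky.
move=> l; rewrite inE bM => /predU1P[-> | sl]; last by rewrite sz // mulg1 yx.
by rewrite -[bot z k]/(coord k z) zk mulKVg.
Qed.

Lemma killedJ h k : h \in H -> killed (top h k) = killed k :^ h :> {set W}.
Proof.
move=> Hh; apply/setP => x; rewrite mem_conjg; apply/killedP/killedP => -[Hx Bx kx].
  split; [by rewrite groupJ ?groupV | exact: baseJ |].
  by rewrite botJ // topV invgK kx conj1g.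
rewrite groupJr ?groupV // in Hx; have Bx' := baseJ h Bx; rewrite conjgKV in Bx'.
split=> //; rewrite -[x](conjgKV h) botJ ?baseJ // permK kx.
by rewrite conj1g.
Qed.

(** The ties between coordinates are invariant under the shift, so they are the
    residue classes modulo some divisor [d] of [m]. If [d = m], then [H] is
    everything; otherwise [m / d] has a prime divisor, so [5 * d <= m], and the
    base part is determined by [d] coordinates. *)
Lemma subdirect_bound h :
    h \in H -> top h = c -> H \proper [set: W] ->
    (forall q, prime q -> q %| m -> 5 <= q) ->
  #|H :&: base gT m| <= #|gT| ^ (m %/ 5).
Proof.
move=> Hh th prH m_primes.
have [m0 | m_gt0] := posnP m.
  have no_ord (k : 'I_m) : False by move: (leq_ltn_trans (leq0n k) (ltn_ord k)); rewrite m0.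
  case/negP: (proper_subn prH); apply/subsetP => x _.
  rewrite (_ : x = 1) //; apply: topbot_inj => [|k].
    by apply/permP => k; case: (no_ord k).
  by case: (no_ord k).
have cm : c ^+ m = 1 by rewrite -[RHS](expg_order c) order_cyc_shift.
pose i0 := Ordinal m_gt0; pose K n := killed ((c ^+ n) i0).
have KJ n l : (K (n + l) = K n :^ (h ^+ l) :> {set W})%g.
  by rewrite /K expgD permM -killedJ ?groupX // topX th.
have shiftK n l e : K n = K l -> K (n + e) = K (l + e).
  by move=> E; apply: val_inj; rewrite /= !KJ E.
have exd : exists d, (0 < d) && (K d == K 0).
  by exists m; rewrite m_gt0 /K cm expg0 eqxx.
(* d generates the periods of K, so the ties are the classes modulo d *)
case: (ex_minnP exd) => d /andP[d_gt0 /eqP Kd] dmin.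
have Kmod n : K n = K (n %% d).
  rewrite {1}(divn_eq n d) addnC; elim: (n %/ d) => [|q IHq]; first by rewrite addn0.
  by rewrite mulSn addnCA (shiftK d 0) // add0n.
have d_dvd_m : d %| m.
  rewrite /dvdn; apply: contraT; rewrite -lt0n => r_gt0.
  have := dmin (m %% d); rewrite r_gt0 -Kmod /K cm.
  by rewrite expg0 eqxx => /(_ isT); rewrite leqNgt ltn_pmod.
have [q Dm] := dvdnP d_dvd_m.
have [q1 | q_gt1] := leqP q 1.
  case/negP: (proper_subn prH).
  have {q1} md : m = d by have := m_gt0; rewrite Dm; case: q Dm q1 => [|[|]] //; lia.
  have injK : injective killed.
    move=> i j; have [a <-] := cyc_shift_trans i0 i; have [b <-] := cyc_shift_trans i0 j.
    rewrite -!/(K _) Kmod [in RHS]Kmod => Eab.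
    suff E : a = b %[mod d].
      rewrite (divn_eq a d) (divn_eq b d) !expgD !(mulnC _ d) !expgM.
      have -> : c ^+ d = 1 by rewrite -[d in LHS]md.
      by rewrite !expg1n !mul1g E.
    (* otherwise the difference of the residues is a period smaller than d *)
    wlog le_ab : a b Eab / a %% d <= b %% d.
      by move=> Hw; have [/Hw->|/ltnW/Hw->] := leqP (a %% d) (b %% d).
    apply/eqP; rewrite eqn_leq le_ab /= leqNgt; apply/negP => lt_ab.
    have := dmin (b %% d - a %% d).
    have := shiftK _ _ (d - a %% d) Eab.
    rewrite subnKC; last by rewrite ltnW // ltn_pmod.
    rewrite Kd Kmod mod0n.
    have -> : b %% d + (d - a %% d) = (b %% d - a %% d) + d.
      by have := ltn_pmod a d_gt0; lia.
    rewrite (Kmod (_ + d)) modnDr -Kmod => <-.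
    rewrite subn_gt0 lt_ab eqxx => /(_ isT).
    by have := ltn_pmod b d_gt0; lia.
  have sBH := killed_inj_full injK.
  apply/subsetP => x _.
  have /cycleP[n xn] := top_in x.
  rewrite -(mulgKV (h ^+ n) x) groupM ?groupX //.
  by apply: (subsetP sBH); apply/baseP; rewrite topM topV topX th xn mulgV.
have le5d : 5 * d <= m.
  rewrite Dm leq_mul2r; apply/orP; right.
  apply: leq_trans (pdiv_leq (ltnW q_gt1)).
  by apply: m_primes (pdiv_prime q_gt1) _; rewrite Dm dvdn_mulr ?pdiv_dvd.
have S_gt0 : 0 < #|gT| by rewrite -cardsT cardG_gt0.
apply: (@leq_trans (#|gT| ^ d)); last by rewrite leq_pexp2l // leq_divRL // mulnC.
rewrite -[X in _ <= X ^ _]cardsT -(card_ord d) -cardsT.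
pose f (x : W) := [ffun l : 'I_d => bot x ((c ^+ l) i0)].
rewrite -(@card_in_imset _ _ f).
  apply: leq_trans (max_card _) _.
  by rewrite card_ffun !cardsT.
move=> x y Kx Ky /ffunP E.
have Kxy : x * y^-1 \in H :&: base _ _ by rewrite groupM ?groupV.
have [/setIP[Hx Bx] /setIP[Hy By]] := (Kx, Ky).
apply: topbot_inj => [|k]; first by rewrite (baseP _ Bx) (baseP _ By).
have [n <-] := cyc_shift_trans i0 k.
have /killedP[_ _ ] : x * y^-1 \in K n.
  rewrite Kmod; apply/killedP; case/setIP: Kxy => -> ->; split=> //.
  have := E (Ordinal (ltn_pmod n d_gt0)); rewrite !ffunE /= => Exy.
  by rewrite bot_div // Exy mulgV.
rewrite bot_div // => /eqP.
by rewrite -eq_mulgV1 => /eqP.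
Qed.

End Subdirect.

(** * Action on tuples of subsets *)

Section TupleAction.

Variables (gT : finGroupType) (m : nat).
Local Notation W := (cyc_wreath gT m).
Local Notation c := (cyc_shift m).
Local Notation setTuple := {ffun 'I_m -> {set gT}}.
Implicit Types (g h x y : W) (i j k : 'I_m) (w : setTuple).

Definition tact w g : setTuple := [ffun k => w ((top g)^-1 k) :^ bot g k].

Lemma tact1 : tact^~ 1 =1 id.
Proof. by move=> w; apply/ffunP => k; rewrite ffunE bot1 conjsg1 invg1 perm1. Qed.

Lemma tactM w : act_morph tact w.
Proof.
by move=> g h; apply/ffunP => k; rewrite !ffunE botM conjsgM topM invMg permM.
Qed.

Canonical tuple_action := TotalAction tact1 tactM.

Definition tstab w : {group W} := [group of 'C[w | tuple_action]].

Lemma tstabP w g :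
  reflect (forall k, w ((top g)^-1 k) :^ bot g k = w k) (g \in tstab w).
Proof.
apply: (iffP astab1P) => [/ffunP E k | E].
  by have := E k; rewrite /= ffunE.
by apply/ffunP => k; rewrite /= ffunE.
Qed.

Lemma tstab_base w x : x \in base gT m ->
  (x \in tstab w) = [forall k, bot x k \in 'N(w k)].
Proof.
move=> /baseP tx; apply/tstabP/forallP => E k.
  by have := E k; rewrite tx invg1 perm1 => ?; apply/normP.
by rewrite tx invg1 perm1; apply/normP.
Qed.

(** Carry [A] along the coordinates by the powers of [g]. The result is well
    defined because [g ^+ m], which returns to the starting coordinate,
    normalizes [A] there. *)
Lemma tact_fixed_exists g k0 (A : {set gT}) :
    <[top g]> = <[c]> -> bot (g ^+ m) k0 \in 'N(A) ->
  exists2 w : setTuple, (forall k, w k \in A :^: [set: gT]) & g \in tstab w.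
Proof.
move=> gen nA; have m_gt0 : 0 < m by apply: leq_trans (ltn_ord k0).
have om : #[top g] = m by rewrite orderE gen -orderE order_cyc_shift.
have topm : top g ^+ m = 1 by rewrite -[RHS](expg_order (top g)) om.
have shiftP k : exists n, (top g ^+ n) k0 == k.
  by have [n <-] := gen_shift_trans k0 k gen; exists n.
pose n k := xchoose (shiftP k).
have nP k : (top g ^+ n k) k0 = k by apply/eqP/(xchooseP (shiftP k)).
have periodic l k q : (top g ^+ l) k0 = k ->
    A :^ bot (g ^+ (q * m + l)) k = A :^ bot (g ^+ l) k.
  move=> <-; elim: q => [|q IHq]; first by [].
  rewrite mulSn -addnA botX_shift conjsgM.
  have -> : (top g ^+ (q * m + l))^-1 ((top g ^+ l) k0) = k0.
    by rewrite expgD mulnC expgM topm expg1n mul1g permK.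
  by rewrite (normP nA).
have modular l l' k : (top g ^+ l) k0 = k -> (top g ^+ l') k0 = k ->
    A :^ bot (g ^+ l) k = A :^ bot (g ^+ l') k.
  have reduce q : (top g ^+ q) k0 = k ->
      A :^ bot (g ^+ q) k = A :^ bot (g ^+ (q %% m)) k.
    by move=> qk; rewrite {1}(divn_eq q m) periodic // expg_mod.
  move=> lk l'k; have E : top g ^+ l = top g ^+ l'.
    apply/eqP; rewrite eq_mulgV1; apply/eqP/(@cycle_shift_free _ _ k0).
      by rewrite -gen groupM ?groupV ?mem_cycle.
    by rewrite permM lk -l'k permK.
  rewrite reduce // [in RHS]reduce //; congr (A :^ bot (g ^+ _) k).
  by have /eqP := E; rewrite eq_expg_mod_order om => /eqP.
exists [ffun k => A :^ bot (g ^+ n k) k] => [k|].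
  by rewrite ffunE imset_f ?inE.
apply/tstabP => k; rewrite !ffunE -conjsgM.
set k' := (top g)^-1 k.
have -> : bot (g ^+ n k') k' * bot g k = bot (g ^+ (n k' + 1)) k.
  by rewrite botX_shift expg1.
apply: modular; last exact: nP.
by rewrite addn1 expgSr permM nP permKV.
Qed.

(** [g] commutes with its power [g ^+ n], which lies in the base. *)
Lemma botX_fixed g n k : top g ^+ n = 1 ->
  bot (g ^+ n) k = bot (g ^+ n) ((top g)^-1 k) ^ bot g k.
Proof.
move=> tn; rewrite -botJ; last by apply/baseP; rewrite topX.
by rewrite conjXg conjgE mulKg.
Qed.

(** Coordinate [k] of [g ^+ n] is the product of the coordinates of [g] at
    [top g ^- l k], with [l = 0] coming last. Multiplying [g] by an element [e]
    that is trivial at the other indices of that product changes only this last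
    factor, so the coordinate can be given any value. *)
Lemma botX_supp g e n k : 0 < n -> top e = 1 ->
    (forall l, 0 < l < n -> bot e ((top g ^+ l)^-1 k) = 1) ->
  bot ((g * e) ^+ n) k = bot (g ^+ n) k * bot e k.
Proof.
move=> n_gt0 te supp.
have tge : top (g * e) = top g by rewrite topM te mulg1.
have botge q : bot (g * e) q = bot g q * bot e q.
  by rewrite botM te invg1 perm1.
have step f (q : 'I_m) l : bot (f ^+ l.+1) q = bot (f ^+ l) ((top f)^-1 q) * bot f q.
  by rewrite -addn1 botX_shift !expg1.
have IH l : l < n -> bot ((g * e) ^+ l) ((top g ^+ (n - l))^-1 k)
                     = bot (g ^+ l) ((top g ^+ (n - l))^-1 k).
  elim: l => [|l IHl] lt_ln; first by rewrite !expg0 !bot1.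
  rewrite !step tge botge supp ?mulg1; last by rewrite subn_gt0 lt_ln; lia.
  have -> : (top g)^-1 ((top g ^+ (n - l.+1))^-1 k) = (top g ^+ (n - l))^-1 k.
    by rewrite -permM -invMg -expgS subnSK 1?ltnW.
  by rewrite IHl 1?ltnW.
case: n n_gt0 supp IH => // n _ supp IH.
rewrite !step tge botge mulgA; congr (_ * _ * _).
by have := IH n (ltnSn n); rewrite subSnn !expg1.
Qed.

End TupleAction.

(** * Counting with fibres *)

Section Counting.

Lemma fiber_bound (T U : finType) (A : {set T}) (B : {set U}) (f : T -> U) n :
    {in A, forall x, f x \in B} ->
    {in B, forall b, #|[set x in A | f x == b]| <= n} ->
  #|A| <= #|B| * n.
Proof.
move=> fAB le_n; rewrite -sum1_card (partition_big f (mem B)) //=.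
rewrite -sum_nat_const; apply: leq_sum => b Bb.
apply: leq_trans (le_n b Bb); rewrite -sum1_card; apply: eq_leq.
by apply: eq_bigl => x; rewrite inE.
Qed.

Lemma fiber_bound_ge (T U : finType) (A : {set T}) (B : {set U}) (f : T -> U) n :
    {in B, forall b, n <= #|[set x in A | f x == b]|} ->
  #|B| * n <= #|A|.
Proof.
move=> ge_n; apply: (@leq_trans #|[set x in A | f x \in B]|); last first.
  by apply/subset_leq_card/subsetP => x /setIdP[].
rewrite -sum_nat_const -[leqRHS]sum1_card.
rewrite (partition_big f (mem B)) => [|x /setIdP[]] //=.
apply: leq_sum => b Bb; apply: leq_trans (ge_n b Bb) _; rewrite -sum1_card.
apply: eq_leq; apply: eq_bigl => x; rewrite !in_set.
by case: eqP => [->|_]; rewrite ?andbF // Bb !andbT.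
Qed.

(** Members of [C] on which [t] is constant meet at most one fibre each. A fibre
    met by none of them has at least [n] elements, all of which must come from
    members with at most [n] elements. *)
Lemma cover_count (T U V : finType) (C : {set U}) (mem_of : U -> {set T})
    (Om : {set V}) (X : {set T}) (t : T -> V) n :
    0 < n ->
    {in Om, forall w, n <= #|[set x in X | t x == w]|} ->
    {in X, forall x, exists2 H, H \in C & x \in mem_of H} ->
    {in C, forall H, (forall x y, x \in X -> y \in X -> x \in mem_of H ->
             y \in mem_of H -> t x = t y) \/ #|mem_of H :&: X| <= n} ->
  #|Om| <= #|C|.
Proof.
move=> n_gt0 large covX typeC.
pose const H := [forall x in X, forall y in X,
  (x \in mem_of H) ==> (y \in mem_of H) ==> (t x == t y)].
pose C1 := [set H in C | const H].
pose val_on H := omap t [pick x in X | x \in mem_of H].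
pose Im := [set w in Om | Some w \in [set val_on H | H in C1]].
have le1 : #|Im| <= #|C1|.
  apply: leq_trans (leq_imset_card val_on (mem C1)).
  rewrite -(card_imset _ (@Some_inj _ : injective (@Some V))); apply/subset_leq_card/subsetP.
  by move=> _ /imsetP[w /setIdP[_ ?] ->].
have le2 : #|Om :\: Im| * n <= #|C :\: C1| * n.
  pose Y := [set x in X | t x \in Om :\: Im].
  apply: (@leq_trans #|Y|).
    rewrite -sum_nat_const -[#|Y|]sum1_card.
    rewrite (partition_big t (mem (Om :\: Im))) => [|x /setIdP[]] //=.
    apply: leq_sum => w Omw; have /setDP[Omw' _] := Omw.
    apply: leq_trans (large w Omw') _; rewrite -sum1_card; apply: eq_leq.
    apply: eq_bigl => x; rewrite 2!in_set; case: eqP => [->|_].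
      by rewrite Omw !andbT.
    by rewrite !andbF.
  apply: (@leq_trans #|\bigcup_(H in C :\: C1) (mem_of H :&: X)|).
    apply/subset_leq_card/subsetP => x /setIdP[Xx /setDP[Omx nIm]].
    have [H CH Hx] := covX x Xx; apply/bigcupP; exists H; last by rewrite inE Hx.
    rewrite inE CH andbT; apply: contra nIm => C1H.
    rewrite inE Omx; apply/imsetP; exists H => //; rewrite /val_on.
    case: pickP => [y /andP[Xy Hy]|/(_ x)] /=; last by rewrite Hx Xx.
    move: C1H; rewrite inE => /andP[_ /forall_inP/(_ x Xx)/forall_inP/(_ y Xy)].
    by rewrite Hx Hy => /eqP ->.
  have card_bigcup (D : {set U}) : #|\bigcup_(H in D) (mem_of H :&: X)| <=
      \sum_(H in D) #|mem_of H :&: X|.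
    elim/big_rec2: _ => [|H k A _ le_k]; first by rewrite cards0.
    by apply: leq_trans (leq_card_setU _ _) _; rewrite leq_add2l.
  apply: leq_trans (card_bigcup _) _; rewrite -sum_nat_const.
  apply: leq_sum => H /setDP[CH nC1]; case: (typeC H CH) => // cst.
  case/negP: nC1; rewrite inE CH; apply/forall_inP => x Xx.
  apply/forall_inP => y Xy; apply/implyP => Hx; apply/implyP => Hy.
  by apply/eqP/cst.
rewrite -(cardsID Im Om) -(cardsID C1 C); apply: leq_add.
  by rewrite (setIidPr _) 1?(setIidPr _) //; apply/subsetP => ? /[!inE] /andP[].
by move: le2; rewrite leq_pmul2r.
Qed.

End Counting.

(** * Covering numbers of cyclic wreath products *)

Section WreathSigma.

Variables (gT : finGroupType) (m : nat) (I : finType) (Hs : I -> {group gT}).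
Local Notation W := (cyc_wreath gT m).
Local Notation c := (cyc_shift m).
Local Notation setTuple := {ffun 'I_m -> {set gT}}.
Local Notation conjs i := (Hs i :^: [set: gT]).
Local Notation generates i := [set x : gT | <[x]> \in conjs i].
Implicit Types (g h x y : W) (k l : 'I_m) (w : setTuple) (H : {group W}).

(* The subgroups Hs i play the roles of a Sylow p-subgroup and of a nonsplit
   torus of PSL(2, p). *)
Hypotheses (simpleS : simple [set: gT]) (nabS : ~~ abelian [set: gT]).
Hypothesis m_gt0 : 0 < m.
Hypothesis m_primes : forall q, prime q -> q %| m -> 5 <= q.
Hypothesis Hs_cyclic : forall i, cyclic (Hs i).
Hypothesis Hs_cover : forall b : gT, exists i a, b \in 'N(Hs i :^ a).
Hypothesis Hs_over : forall i (P : {group gT}),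
  P \proper [set: gT] -> Hs i \subset P -> P \subset 'N(Hs i).
Hypothesis Hs_indep : forall i j, i != j -> ~~ (#|Hs i| %| #|'N(Hs j)|).
Hypothesis Hs_isolated : forall i a, Hs i :^ a \subset 'N(Hs i) -> Hs i :^ a = Hs i.

Let conjsP i (A : {set gT}) : reflect (exists a, A = Hs i :^ a) (A \in conjs i).
Proof.
by apply: (iffP imsetP) => [[a _ ->]|[a ->]]; exists a; rewrite ?inE.
Qed.

Let card_conjs i (A : {set gT}) : A \in conjs i -> #|A| = #|Hs i|.
Proof. by case/conjsP => a ->; rewrite cardJg. Qed.

Lemma generatesJ i (y a : gT) : y \in generates i -> y ^ a \in generates i.
Proof.
rewrite !inE cycleJ => /conjsP[b ->]; apply/conjsP; exists (b * a).
by rewrite conjsgM.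
Qed.

(** The order of [Hs i] separates the indices, and [Hs_isolated] the conjugates
    with the same index. *)
Lemma generates_normalizes i j (y : gT) (A : {set gT}) :
  y \in generates i -> A \in conjs j -> y \in 'N(A) -> i = j /\ A = <[y]>.
Proof.
rewrite inE => /conjsP[a Dy] /conjsP[b DA]; rewrite -cycle_subG Dy DA => nA.
have {}nA : Hs i :^ (a * b^-1) \subset 'N(Hs j).
  by rewrite conjsgM sub_conjgV -normJ.
have eij : i = j.
  by apply: contraTeq (cardSg nA) => /Hs_indep; rewrite cardJg.
split=> //; subst j; have := Hs_isolated nA.
by rewrite conjsgM => /(congr1 (fun B : {set gT} => B :^ b)); rewrite conjsgKV => ->.
Qed.

Lemma generates_over i (y : gT) (P : {group gT}) :
  P \proper [set: gT] -> y \in generates i -> y \in P -> P \subset 'N(<[y]>).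
Proof.
rewrite inE => prP /conjsP[a Dy]; rewrite -cycle_subG Dy => sP.
rewrite normJ -sub_conjgV -[_ :^ _]/(gval (P :^ a^-1)%G); apply: Hs_over.
  by rewrite properEcard subsetT /= cardJg; apply: proper_card.
by rewrite /= -sub_conjg.
Qed.

Lemma generates_exists i (A : {set gT}) :
  A \in conjs i -> exists2 y, y \in generates i & A = <[y]>.
Proof.
move=> cA; have /conjsP[a DA] := cA; have /cyclicP[y Dy] := Hs_cyclic i.
by exists (y ^ a); rewrite ?inE cycleJ -Dy -?DA.
Qed.

Lemma card_generates i : #|generates i| = (#|conjs i| * totient #|Hs i|)%N.
Proof.
rewrite -sum1_card (partition_big (fun y : gT => <[y]>) (mem (conjs i))) => [|y]; last first.
  by rewrite inE.
rewrite -sum_nat_const; apply: eq_bigr => A cA.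
have [y gy DA] := generates_exists cA.
have -> : #|Hs i| = #[y] by have /conjsP[a DA'] := cA; rewrite orderE -DA DA' cardJg.
rewrite totient_gen -sum1_card; apply: eq_bigl => z; rewrite !inE /generator -DA.
rewrite [RHS]eq_sym; case: eqP => [->|]; last by rewrite andbF.
by rewrite andbT; apply: cA.
Qed.

Lemma order_Hs_gt1 i j : i != j -> Hs i :!=: 1.
Proof. by move=> /Hs_indep; apply: contraNneq => ->; rewrite cards1 dvd1n. Qed.

(** A tuple of conjugates of [Hs i] stands for their direct product, a subgroup
    of the base whose normalizer is the stabilizer of the tuple. *)
Definition tuples i : {set setTuple} := [set w in ffun_on (mem (conjs i))].

Lemma tuplesP i w : reflect (forall k, w k \in conjs i) (w \in tuples i).
Proof. by rewrite inE; apply: (iffP ffun_onP). Qed.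

Lemma card_tuples i : #|tuples i| = (#|conjs i| ^ m)%N.
Proof. by rewrite cardsE card_ffun_on card_ord. Qed.

Definition all_tuples : {set setTuple} := \bigcup_i tuples i.

Lemma card_all_tuples : #|all_tuples| = \sum_i #|conjs i| ^ m.
Proof.
rewrite -sum1_card /all_tuples partition_disjoint_bigcup => [|i j neq]; last first.
  apply/pred0P => w /=; apply/negP => /andP[/tuplesP wi /tuplesP wj].
  case/negP: (Hs_indep neq); pose k0 := Ordinal m_gt0.
  rewrite -(card_conjs (wi k0)) (card_conjs (wj k0)).
  exact: cardSg (normG _).
by apply: eq_bigr => i _; rewrite sum1_card card_tuples.
Qed.

Lemma base_elt k (a : gT) : exists x, [/\ x \in base gT m, bot x k = a
   & forall l, l != k -> bot x l = 1].
Proof.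
have [t b] := wreath_eltE (fun l => if l == k then a else 1) (group1 <[c]>).
exists (wreath_elt 1 (fun l => if l == k then a else 1)); split=> [||l /negPf nlk].
- by apply/baseP.
- by rewrite b eqxx.
- by rewrite b nlk.
Qed.

(** For [r] prime this is the normal subgroup of index [r] that contains the
    base. *)
Definition index_sub r : {group W} := [group of @top gT m @*^-1 <[c ^+ r]>].

Lemma index_subP r g : (g \in index_sub r) = (top g \in <[c ^+ r]>).
Proof. by rewrite !inE. Qed.

Lemma top_shift_exists s : s \in <[c]> -> exists g, top g = s.
Proof. by move=> /(wreath_eltE (fun _ => 1 : gT))[]; exists (wreath_elt s (fun=> 1)). Qed.

Lemma index_sub_proper r : prime r -> r %| m -> index_sub r \proper [set: W].
Proof.
move=> pr_r r_dvd; rewrite properT; apply/eqP => full.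
have [g tg] := top_shift_exists (cycle_id c).
have : g \in index_sub r by rewrite full inE.
rewrite index_subP tg -cycle_subG => /subset_leq_card.
rewrite -!orderE orderXdiv order_cyc_shift // leqNgt ltn_Pdiv //.
exact: prime_gt1.
Qed.

(** Otherwise the base would normalize the tuple, and a conjugate of [Hs i] would
    be a nontrivial cyclic normal subgroup of a nonabelian simple group. *)
Lemma tstab_proper i j w : i != j -> w \in tuples i -> tstab w \proper [set: W].
Proof.
move=> neq /tuplesP wi; rewrite properT; apply/eqP => full.
have /conjsP[a Da] := wi (Ordinal m_gt0).
have nwk : [set: gT] \subset 'N(Hs i :^ a).
  apply/subsetP => b _; have [x [Bx <- _]] := base_elt (Ordinal m_gt0) b.
  have : x \in tstab w by rewrite full inE.
  by rewrite tstab_base // -Da => /forallP.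
have [_ simp] := simpleP _ simpleS.
case: (simp (Hs i :^ a)%G); first by rewrite /normal subsetT.
  move=> /= triv; case/eqP: (order_Hs_gt1 neq); apply/trivgP.
  by rewrite -(conjsgK a (Hs i)) triv conjs1g.
move=> /= full'; case/negP: nabS; rewrite -full'.
by rewrite abelianJ cyclic_abelian.
Qed.

(** An element over a generator of the top group stabilizes a tuple; any other
    lies over [c ^+ r] for a prime divisor [r] of [m]. *)
Lemma sigma_cyc_wreath_le (i1 i2 : I) : i1 != i2 ->
  sigma [set: W]%G <= size (primes m) + \sum_i #|conjs i| ^ m.
Proof.
move=> neq12; pose C := [set H in map index_sub (primes m)] :|: [set tstab w | w in all_tuples].
have cardC : #|C| <= size (primes m) + \sum_i #|conjs i| ^ m.
  apply: leq_trans (leq_card_setU _ _) _; rewrite -card_all_tuples.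
  apply: leq_add; last exact: leq_imset_card.
  by rewrite cardsE; apply: leq_trans (card_size _) _; rewrite size_map.
apply: leq_trans cardC; apply: sigma_min; apply/andP; split.
  apply/forall_inP => H; rewrite in_setU => /orP[].
    rewrite inE => /mapP[r]; rewrite mem_primes => /and3P[pr_r _ r_dvd] ->.
    exact: index_sub_proper.
  case/imsetP => w /bigcupP[i _ wi] ->.
  have [ei | ni] := eqVneq i i1; last exact: tstab_proper ni wi.
  by apply: (@tstab_proper i i2) wi; rewrite ei.
rewrite eqEsubset; apply/andP; split; first by apply/bigcupsP => H _; apply: subsetT.
apply/subsetP => g _.
have /cycleP[n tg] := top_in g.
have [co | nco] := boolP (coprime m n).
  have gen : <[top g]> = <[c]>.
    apply/esym/eqP; rewrite -/(generator _ _) tg generator_coprime.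
    by rewrite order_cyc_shift.
  pose k0 := Ordinal m_gt0.
  have [i [a na]] := Hs_cover (bot (g ^+ m) k0).
  have [w wi gw] := tact_fixed_exists gen na.
  apply/bigcupP; exists (tstab w) => //; rewrite in_setU; apply/orP; right.
  apply: imset_f; apply/bigcupP; exists i => //; apply/tuplesP => k.
  have /imsetP[b _ ->] := wi k; apply/conjsP; exists (a * b).
  by rewrite conjsgM.
have gcd_gt1 : 1 < gcdn m n.
  by rewrite ltn_neqAle eq_sym nco gcdn_gt0 m_gt0.
pose r := pdiv (gcdn m n); have pr_r : prime r := pdiv_prime gcd_gt1.
have r_dvd : r %| gcdn m n := pdiv_dvd _.
rewrite dvdn_gcd in r_dvd; case/andP: r_dvd => r_m r_n.
apply/bigcupP; exists (index_sub r).
  rewrite in_setU inE; apply/orP; left; apply/map_f.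
  by rewrite mem_primes pr_r m_gt0 r_m.
by rewrite index_subP tg -(divnK r_n) mulnC expgM mem_cycle.
Qed.

Let k0 := Ordinal m_gt0.
Let cm : c ^+ m = 1.
Proof. by rewrite -[RHS](expg_order c) order_cyc_shift. Qed.

Lemma shift_ind (Q : 'I_m -> Prop) k :
  Q k -> (forall l, Q l -> Q (c l)) -> forall l, Q l.
Proof.
move=> Qk IH l; have [n <-] := cyc_shift_trans k l.
by elim: n => [|n IHn]; rewrite ?expg0 ?perm1 // expgSr permM; apply: IH.
Qed.

(** The only tuple that [g] can stabilize when [g] lies over [c] and the
    coordinates of [g ^+ m] are generators. *)
Definition tup g : setTuple := [ffun k => <[bot (g ^+ m) k]>].

Lemma generates_all g i k : top g = c ->
  bot (g ^+ m) k \in generates i -> forall l, bot (g ^+ m) l \in generates i.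
Proof.
move=> tg gk; apply: (shift_ind gk) => l gl.
by rewrite botX_fixed tg // permK; apply: generatesJ.
Qed.

Lemma tup_unique g i j w k : top g = c -> bot (g ^+ m) k \in generates i ->
  w \in tuples j -> g \in tstab w -> tup g = w.
Proof.
move=> tg gk /tuplesP wj gw; apply/ffunP => l; rewrite ffunE.
have Bgm : g ^+ m \in base gT m by apply/baseP; rewrite topX tg.
have : g ^+ m \in tstab w by rewrite groupX.
rewrite tstab_base // => /forallP/(_ l) nl.
by have [_ ->] := generates_normalizes (generates_all tg gk l) (wj l) nl.
Qed.

Lemma coord_dichotomy H h : h \in H -> top h = c ->
  (forall k, coord k @* H = [set: gT]) \/ (forall k, coord k @* H \proper [set: gT]).
Proof.
move=> Hh th; have conjH k := coord_im_conj k Hh; rewrite th in conjH.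
have [full | nfull] := eqVneq (coord k0 @* H) [set: gT]; [left | right].
  by apply: (shift_ind full) => k fk; rewrite conjH fk conjGid ?inE.
apply: (shift_ind (k := k0)) => [|k]; rewrite !properT // conjH; apply: contraNneq => E.
by apply/eqP; rewrite -(conjsgK (bot h (c k)) (coord k @* H)) E conjGid ?inE.
Qed.

Lemma coord_mem g H k : g \in H -> g \in base gT m -> bot g k \in coord k @* H.
Proof. by move=> Hg Bg; apply: (mem_morphim (coord_morphism gT k)). Qed.

(** Each projection of [H] is proper and contains a coordinate of [g ^+ m], so it
    normalizes the subgroup which that coordinate generates. Conjugating by an
    element of [H] sends this coordinate to a generator that lies in another
    projection, and therefore generates the subgroup already there. *)
Lemma proper_sub_tstab H g i : (forall k, coord k @* H \proper [set: gT]) ->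
    g \in H -> top g = c -> bot (g ^+ m) k0 \in generates i ->
  H \subset tstab (tup g).
Proof.
move=> prH Hg tg /generates_all-/(_ tg) gen.
have Bgm : g ^+ m \in base gT m by apply/baseP; rewrite topX tg.
have nP k := generates_over (prH k) (gen k) (coord_mem k (groupX m Hg) Bgm).
apply/subsetP => h Hh; apply/tstabP => k; rewrite !ffunE -cycleJ.
have ck : <[bot (g ^+ m) k]> \in conjs i by have := gen k; rewrite inE.
have genJ := generatesJ (bot h k) (gen ((top h)^-1 k)).
have [|_ ->] // := generates_normalizes genJ ck _.
apply: (subsetP (nP k)); rewrite -botJ //; apply: coord_mem; last exact: baseJ.
by rewrite groupJ ?groupX.
Qed.

(** The largest possible number of elements over [c] in a proper subgroup with
    full projections. *)
Let mu := (#|gT| ^ (m %/ 5))%N.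

Let S_gt0 : 0 < #|gT|. Proof. by rewrite -cardsT cardG_gt0. Qed.
Let mu_gt0 : 0 < mu. Proof. by rewrite expn_gt0 S_gt0. Qed.

Lemma full_small H h s : H \proper [set: W] -> h \in H -> top h = c ->
    (forall k, coord k @* H = [set: gT]) ->
  #|[set x in H | top x == s]| <= mu.
Proof.
move=> prH Hh th full.
have [-> | [g]] := set_0Vmem [set x in H | top x == s]; first by rewrite cards0.
rewrite inE => /andP[Hg /eqP <-]; rewrite top_fiber // card_rcoset.
exact: (subdirect_bound simpleS nabS full Hh th prH m_primes).
Qed.

(** An element over [c] stabilizes [w] when its coordinates conjugate each entry
    of [w] to the next one; each coordinate then varies in a coset of the
    normalizer of an entry. The
    coordinate [k0] of their [m]-th powers is equidistributed over the
    normalizer of [w k0], since it can be multiplied by any element of it; so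
    fixing it to be a chosen generator divides the count by the order of the
    normalizer. *)
Lemma card_tup_fiber i w : w \in tuples i ->
  #|'N(Hs i)| ^ m.-1 <=
  #|[set g in [set g | (top g == c) && [exists j, bot (g ^+ m) k0 \in generates j]]
      | tup g == w]|.
Proof.
move=> wi; have wP := tuplesP _ _ wi.
have exu k : exists a, w k == Hs i :^ a by have /conjsP[a ->] := wP k; exists a.
pose u k := xchoose (exu k); have uP k : w k = Hs i :^ u k by apply/eqP/(xchooseP (exu k)).
pose T := [set g in tstab w | top g == c].
(* the element of T attached to a family of m elements of the normalizer *)
have leT : #|'N(Hs i)| ^ m <= #|T|.
  pose f (a : {ffun 'I_m -> gT}) := wreath_elt c (fun k => (u (c^-1 k))^-1 * a k * u k).
  have fE a : top (f a) = c /\ bot (f a) =1 fun k => (u (c^-1 k))^-1 * a k * u k.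
    by apply: wreath_eltE; apply: cycle_id.
  have inj : injective f.
    move=> a b E; apply/ffunP => k; have [_ fa] := fE a; have [_ fb] := fE b.
    have := fa k; rewrite E fb => /mulIg/mulgI.
    by [].
  have <- : #|@ffun_on_mem 'I_m gT (mem 'N(Hs i))| = (#|'N(Hs i)| ^ m)%N.
    by rewrite card_ffun_on card_ord.
  rewrite -(card_imset _ inj).
  apply/subset_leq_card/subsetP => _ /imsetP[a /ffun_onP aP ->].
  have [tf bf] := fE a; rewrite inE tf eqxx andbT; apply/tstabP => k.
  rewrite tf bf uP uP -conjsgM !mulgA mulgV mul1g conjsgM.
  by have /normP -> := aP k.
have wk0 := wP k0; have [y0 gy0 Dw] := generates_exists wk0.
pose T0 := [set g in T | bot (g ^+ m) k0 == y0].
have Bgm g : g \in T -> g ^+ m \in base gT m.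
  by rewrite inE => /andP[_ /eqP tg]; apply/baseP; rewrite topX tg.
have nTk g k : g \in T -> bot (g ^+ m) k \in 'N(w k).
  move=> Tg; have := Bgm g Tg; move: Tg; rewrite inE => /andP[wg _] B.
  by have := groupX m wg; rewrite tstab_base // => /forallP.
have le0 : #|T| <= #|'N(w k0)| * #|T0|.
  apply: (fiber_bound (f := fun g => bot (g ^+ m) k0)) => [g|b nb]; first exact: nTk.
  have [e [Be ek0 ek]] := base_elt k0 (b^-1 * y0).
  rewrite -(card_imset _ (mulIg e)); apply/subset_leq_card/subsetP.
  move=> _ /imsetP[g /setIdP[Tg /eqP bg] ->].
  have := Tg; rewrite inE => /andP[wg /eqP tg].
  have ew : e \in tstab w.
    rewrite tstab_base //; apply/forallP => k.
    have [-> | nk] := eqVneq k k0; last by rewrite ek ?group1.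
    by rewrite ek0 groupM ?groupV // Dw (subsetP (normG _)) ?cycle_id.
  rewrite inE inE groupM // topM tg (baseP _ Be) mulg1 eqxx /=.
  rewrite botX_supp // ?(baseP _ Be) //.
    by rewrite bg ek0 mulKVg.
  move=> l /andP[l_gt0 l_lt]; apply: ek; apply: contraTneq l_gt0 => E.
  rewrite -leqNgt; have : c ^+ l = 1.
    apply/eqP; rewrite -eq_invg1; apply/eqP/(@cycle_shift_free _ _ k0).
      by rewrite groupV mem_cycle.
    by rewrite -tg.
  move/eqP; rewrite -order_dvdn order_cyc_shift // => m_l; rewrite leqn0.
  by apply: contraLR l_lt => l0; rewrite -leqNgt dvdn_leq ?lt0n.
have : #|'N(Hs i)| ^ m.-1 <= #|T0|.
  move: (leq_trans leT le0).
  have -> : #|'N(w k0)| = #|'N(Hs i)| by have /conjsP[a ->] := wk0; rewrite normJ cardJg.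
  by rewrite -{1}(prednK m_gt0) expnS leq_pmul2l ?cardG_gt0.
move/leq_trans; apply; apply/subset_leq_card/subsetP => g.
rewrite inE => /andP[Tg /eqP bg]; have := Tg; rewrite inE => /andP[wg /eqP tg].
rewrite !in_set tg eqxx /=; apply/andP; split.
  by apply/existsP; exists i; rewrite bg.
by apply/eqP; apply: (@tup_unique _ i i _ k0) => //; rewrite bg.
Qed.

Definition supplement H := [exists g in H, top g == c].

Hypothesis mu_le_norm : forall i, #|gT| ^ (m %/ 5) <= #|'N(Hs i)| ^ m.-1.

(** [cover_count], with [tup] as the map: a member with proper projections meets
    a single fibre of [tup], and a member with full projections is small. *)
Lemma card_supplements (C : {set {group W}}) : subgroup_cover [set: W] C ->
  \sum_i #|conjs i| ^ m <= #|[set H in C | supplement H]|.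
Proof.
case/andP=> /forall_inP prC /eqP covC; rewrite -card_all_tuples.
set X := [set g : W | (top g == c) && [exists j, bot (g ^+ m) k0 \in generates j]].
apply: (@cover_count _ _ _ _ (fun H : {group W} => H : {set W}) all_tuples X tup mu) => //.
- move=> w /bigcupP[i _ wi]; exact: leq_trans (mu_le_norm i) (card_tup_fiber wi).
- move=> x; rewrite inE => /andP[/eqP tx _]; have : x \in [set: W] by rewrite inE.
  rewrite -covC => /bigcupP[H CH Hx]; exists H => //.
  by rewrite inE CH; apply/exists_inP; exists x => //; apply/eqP.
move=> H; rewrite inE => /andP[CH /exists_inP[h Hh /eqP th]].
have prH := prC H CH; have [full | prP] := coord_dichotomy Hh th; [right | left].
  apply: leq_trans (full_small c prH Hh th full); apply/subset_leq_card/subsetP => x.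
  by rewrite !inE => /andP[-> /andP[-> _]].
move=> x y; rewrite !inE => /andP[/eqP tx /existsP[i gx]] /andP[/eqP ty /existsP[j gy]] Hx Hy.
have sub := proper_sub_tstab prP Hx tx gx.
apply/esym; apply: (tup_unique ty gy _ (subsetP sub y Hy)) => //.
by apply/(tuplesP i) => k; have := generates_all tx gx k; rewrite ffunE inE.
Qed.

(** The counted elements lie over [c ^+ r], and their power [m / r] generates a
    conjugate of [Hs i1] at one index and a conjugate of [Hs i2] at another. A
    member with proper projections contains none of them: its projections are
    conjugate, so one of them would contain both generators and normalize the
    second, against [generates_normalizes]. Every member thus contains at most
    [mu] of them. *)
Lemma cover_large (C : {set {group W}}) r (i1 i2 : I) :
    subgroup_cover [set: W] C -> prime r -> r %| m -> i1 != i2 ->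
    (forall H g, H \in C -> g \in H -> top g = c ^+ r -> supplement H) ->
  #|generates i1| * #|generates i2| * #|gT| ^ (m - 2) <= #|C| * mu.
Proof.
case/andP=> /forall_inP prC /eqP covC pr_r r_m neq12 supC.
have r_gt0 := prime_gt0 pr_r; have r_gt1 := prime_gt1 pr_r.
pose q := m %/ r; have qr : (r * q)%N = m by rewrite mulnC divnK.
have q_gt0 : 0 < q by rewrite divn_gt0 // dvdn_leq.
(* k0 and c k0 lie in different cycles of c ^+ r *)
pose k1 := c k0; pose T := [set g : W | top g == c ^+ r].
pose psi g := (bot (g ^+ q) k0, bot (g ^+ q) k1).
pose Z := setX (generates i1) (generates i2).
pose X := [set g in T | psi g \in Z].
have shift_neq (l : nat) k : 0 < l < q -> ((c ^+ r) ^+ l)^-1 k != k.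
  move=> /andP[l_gt0 l_lt]; apply: contraTneq l_gt0 => E.
  have : (c ^+ r) ^+ l = 1.
    apply/eqP; rewrite -eq_invg1; apply/eqP/(@cycle_shift_free _ _ k) => //.
    by rewrite groupV -expgM mem_cycle.
  rewrite -expgM => /eqP; rewrite -order_dvdn order_cyc_shift // -{1}qr dvdn_pmul2l // => q_l.
  rewrite -leqNgt leqn0; apply: contraLR l_lt => l0; rewrite -leqNgt dvdn_leq ?lt0n //.
have mod_r n1 n2 : (c ^+ n1) k0 = (c ^+ n2) k0 -> n1 = n2 %[mod r].
  move=> E; have : c ^+ n1 = c ^+ n2.
    apply/eqP; rewrite eq_mulgV1; apply/eqP/(@cycle_shift_free _ _ k0) => //.
      by rewrite groupM ?groupV ?mem_cycle.
    by rewrite permM E permK.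
  move/eqP; rewrite eq_expg_mod_order order_cyc_shift // => /eqP E'.
  by rewrite -(modn_dvdm n1 r_m) E' modn_dvdm.
have neq01 : k0 != k1.
  apply/eqP => E; have := mod_r 0 1%N; rewrite expg0 perm1 expg1 => /(_ E).
  by rewrite mod0n modn_small.
have shift01 (l : nat) : ((c ^+ r) ^+ l)^-1 k0 != k1.
  apply/eqP => /(congr1 ((c ^+ r) ^+ l)); rewrite permKV /k1 -permM.
  rewrite -{1}(expg1 c) -expgM -expgD => E; have := mod_r 0 (1 + r * l)%N.
  rewrite expg0 perm1 => /(_ E) /esym; rewrite mod0n addnC mulnC modnMDl modn_small //.
have shift10 (l : nat) : ((c ^+ r) ^+ l)^-1 k1 != k0.
  apply/eqP => /(congr1 ((c ^+ r) ^+ l)); rewrite permKV /k1.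
  rewrite -{1}(expg1 c) -expgM => E; have := mod_r 1%N (r * l)%N E.
  by rewrite mulnC modnMl modn_small.
(* psi is equidistributed, because both coordinates can be adjusted freely *)
have fib_le b b' : #|[set g in T | psi g == b]| <= #|[set g in T | psi g == b']|.
  have [e0 [Be0 e00 e0k]] := base_elt k0 (b.1^-1 * b'.1).
  have [e1 [Be1 e11 e1k]] := base_elt k1 (b.2^-1 * b'.2).
  have Be : e0 * e1 \in base gT m by rewrite groupM.
  have be k : bot (e0 * e1) k = bot e0 k * bot e1 k := bot_morphM k Be0 Be1.
  rewrite -(card_imset _ (mulIg (e0 * e1))); apply/subset_leq_card/subsetP.
  move=> _ /imsetP[g /setIdP[Tg /eqP gb] ->].
  rewrite -gb /= in e00 e11; have /eqP tg : top g == c ^+ r by rewrite inE in Tg.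
  rewrite !in_set topM tg (baseP _ Be) mulg1 eqxx /=; apply/eqP.
  rewrite /psi !botX_supp // ?(baseP _ Be) ?be //.
  - by rewrite e00 e11 e0k 1?eq_sym // e1k // mulg1 mul1g !mulKVg; case: (b').
  - by move=> l lq; rewrite tg be (e0k _ (shift10 l)) (e1k _ (shift_neq l k1 lq)) mulg1.
  - by move=> l lq; rewrite tg be (e0k _ (shift_neq l k0 lq)) (e1k _ (shift01 l)) mulg1.
have cardT : #|T| = (#|gT| ^ m)%N.
  have [g tg] := top_shift_exists (mem_cycle c r).
  rewrite -card_base -[RHS](card_rcoset _ g).
  have := top_fiber (in_setT g); rewrite setTI => <-.
  by apply: eq_card => x; rewrite !inE tg.
have m_ge2 : 2 <= m by apply: leq_trans (dvdn_leq m_gt0 r_m).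
have fib_ge b : #|gT| ^ (m - 2) <= #|[set g in T | psi g == b]|.
  have := fiber_bound (A := T) (B := [set: gT * gT]) (f := psi)
    (n := #|[set g in T | psi g == b]|) (fun x _ => in_setT _) (fun b' _ => fib_le b' b).
  rewrite cardT cardsT card_prod -{1}(subnK m_ge2) expnD mulnC -mulnn.
  by rewrite leq_pmul2l // muln_gt0 S_gt0.
apply: (@leq_trans #|X|).
  rewrite -cardsX; apply: (fiber_bound_ge (f := psi)) => b Zb.
  apply: leq_trans (fib_ge b) _; apply/subset_leq_card/subsetP => g.
  rewrite !in_set => /andP[-> /eqP E]; move: Zb; rewrite -E in_setX !in_set /= => -> /=.
  by rewrite eqxx.
pose pickH (g : W) := odflt 1%G [pick H in C | g \in H].
have pickHP g : pickH g \in C /\ g \in pickH g.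
  rewrite /pickH; case: pickP => [H /andP[] // | no].
  have : g \in [set: W] by rewrite inE.
  by rewrite -covC => /bigcupP[H CH Hg]; have := no H; rewrite CH Hg.
apply: (fiber_bound (f := pickH)) => [g _ | H CH]; first by case: (pickHP g).
have [-> | [g]] := set_0Vmem [set x in X | pickH x == H]; first by rewrite cards0.
rewrite inE => /andP[Xg /eqP DH]; have [_ Hg] := pickHP g; rewrite DH in Hg.
move: Xg; rewrite inE in_setX => /andP[/[!inE] /eqP tg /andP[gen1 gen2]].
have /exists_inP[h Hh /eqP th] := supC H g CH Hg tg.
have prH := prC H CH; have [full | prP] := coord_dichotomy Hh th.
  apply: leq_trans (full_small (c ^+ r) prH Hh th full).
  apply/subset_leq_card/subsetP => x; rewrite inE => /andP[Xx /eqP DHx].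
  have [_ Hx] := pickHP x; rewrite DHx in Hx.
  by move: Xx; rewrite !inE Hx => /andP[].
have Bgq : g ^+ q \in base gT m by apply/baseP; rewrite topX tg -expgM qr.
have g1 : bot (g ^+ q) k0 \in generates i1 by rewrite inE.
have g2 : bot (g ^+ q) k1 \in generates i2 by rewrite inE.
have nP := generates_over (prP k1) g2 (coord_mem k1 (groupX q Hg) Bgq).
have n1 : bot (g ^+ q) k0 ^ bot h k1 \in 'N(<[bot (g ^+ q) k1]>).
  apply: (subsetP nP); have -> : k0 = (top h)^-1 k1 by rewrite th permK.
  by rewrite -botJ //; apply: coord_mem; rewrite ?baseJ // groupJ ?groupX.
case/negP: neq12; apply/eqP.
by have [] := generates_normalizes (generatesJ (bot h k1) g1) gen2 n1.
Qed.

Lemma cyc_wreath_noncyclic : ~~ cyclic [set: W].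
Proof.
apply: contra nabS => /cyclic_abelian/centsP ab; apply/centsP => a _ b _.
have [x [Bx bx _]] := base_elt k0 a; have [y [By yb _]] := base_elt k0 b.
have := ab x (in_setT x) y (in_setT y) => /(congr1 (fun z => bot z k0)).
by rewrite !(bot_morphM k0) // bx yb.
Qed.

(** If every prime divisor [r] of [m] has a member that meets the coset over
    [c ^+ r] but not that over [c], these members are distinct: one that serves
    two primes would contain an element over [c] by Bezout. They come on top of
    those counted by [card_supplements]. If some [r] has none, [cover_large]
    applies. *)
Lemma sigma_cyc_wreath_ge (i1 i2 : I) : i1 != i2 ->
    (1 < m -> #|gT| ^ (m %/ 5) * (size (primes m) + \sum_i #|conjs i| ^ m)
       <= #|generates i1| * #|generates i2| * #|gT| ^ (m - 2)) ->
  size (primes m) + \sum_i #|conjs i| ^ m <= sigma [set: W]%G.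
Proof.
move=> neq12 large; have [C covC <-] := sigma_attained cyc_wreath_noncyclic.
pose C0 := [set H in C | ~~ supplement H].
have [/allP allr | /allPn[r r_m nor]] := boolP (all (fun r =>
    [exists H in C0, [exists g in H, top g == c ^+ r]]) (primes m)).
  rewrite -(cardsID [set H | supplement H] C) addnC; apply: leq_add.
    apply: leq_trans (card_supplements covC) _; apply/subset_leq_card/subsetP => H.
    by rewrite !inE.
  have DC0 : C :\: [set H | supplement H] = C0.
    by apply/setP => H; rewrite !inE andbC.
  rewrite DC0; pose F r := odflt 1%G [pick H in C0 | [exists g in H, top g == c ^+ r]].
  have FP r : r \in primes m -> F r \in C0 /\ exists2 g, g \in F r & top g = c ^+ r.
    move=> /allr/exists_inP[H C0H Hr]; rewrite /F; case: pickP => [L|/(_ H)].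
      by move=> /andP[C0L /exists_inP[g Lg /eqP tg]]; split=> //; exists g.
    by rewrite C0H Hr.
  rewrite -(size_map F) -(@card_uniqP _ (map F (primes m)) _).
    by apply/subset_leq_card/subsetP => _ /mapP[r /FP[C0F _] ->].
  rewrite map_inj_in_uniq ?primes_uniq // => r s r_m s_m E.
  apply: contraTeq (FP r r_m).1 => neq.
  have [_ [g Fg tg]] := FP r r_m; have [_ [h Fh th]] := FP s s_m; rewrite -E in Fh.
  rewrite inE negb_and; apply/orP; right; rewrite negbK.
  move: r_m s_m; rewrite !mem_primes => /and3P[pr_r _ _] /and3P[pr_s _ _].
  have co : coprime r s by rewrite prime_coprime // dvdn_prime2.
  have [u v uv _] := egcdnP s (prime_gt0 pr_r).
  apply/exists_inP; exists (g ^+ u * h ^- v); first by rewrite groupM ?groupV ?groupX.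
  rewrite topM topV !topX tg th -!expgM mulnC uv (eqP co) addnC expgD expg1.
  by rewrite [(v * s)%N]mulnC mulgK.
have : #|C| * mu >= mu * (size (primes m) + \sum_i #|conjs i| ^ m).
  move: r_m; rewrite mem_primes => /and3P[pr_r _ r_dvd].
  apply: leq_trans (large _) _.
    exact: leq_trans (prime_gt1 pr_r) (dvdn_leq m_gt0 r_dvd).
  apply: (cover_large covC pr_r r_dvd neq12) => H g CH Hg tg.
  apply: contraNT nor => nsup; apply/exists_inP; exists H; first by rewrite inE CH.
  by apply/exists_inP; exists g => //; apply/eqP.
by rewrite mulnC leq_pmul2r.
Qed.

(** The first estimate assumed says that a tuple has at least as many elements
    attached to it as a subgroup of diagonal type has over [c]; the second, that
    such subgroups cannot cover the elements of [cover_large]. *)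
Theorem sigma_cyc_wreath (i1 i2 : I) : i1 != i2 ->
    (1 < m -> #|gT| ^ (m %/ 5) * (size (primes m) + \sum_i #|conjs i| ^ m) <=
       #|conjs i1| * totient #|Hs i1| * (#|conjs i2| * totient #|Hs i2|) *
       #|gT| ^ (m - 2)) ->
  sigma [set: W]%G = size (primes m) + \sum_i #|conjs i| ^ m.
Proof.
move=> neq12 large; apply/eqP.
rewrite eqn_leq (sigma_cyc_wreath_le neq12) (sigma_cyc_wreath_ge neq12) //.
by rewrite !card_generates.
Qed.

End WreathSigma.

(** * Numerical estimates *)

Section Numerics.
Local Open Scope nat_scope.

(* S is the order of PSL(2, p), n the number of its nonsplit tori, and m %/ 5
   bounds the number of diagonals of a subdirect subgroup. *)
Variables (p m n S : nat).
Hypotheses (p_ge11 : 11 <= p) (n_eq : 2 * n = p * p.-1) (S_eq : S = n * p.+1).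

Lemma leq_expn2r x y k : x <= y -> x ^ k <= y ^ k.
Proof. by case: k => // k; rewrite leq_exp2r. Qed.

Lemma order_le_cube : S <= p.+1 ^ 3.
Proof.
have : 2 * n <= p.+1 * p.+1 by rewrite n_eq leq_mul // -ltnS; lia.
by rewrite S_eq expnSr leq_mul2r /=; rewrite -mulnn; lia.
Qed.

(** For [k] the order of the normalizer of a Sylow subgroup or of a torus. The
    bound holds since [S <= (p + 1) ^ 3] and [3 * (m %/ 5) < m]. *)
Lemma norm_pow_bound k : p.+1 <= k -> 0 < m -> S ^ (m %/ 5) <= k ^ m.-1.
Proof.
move=> le_k m_gt0; apply: (@leq_trans ((p.+1 ^ 3) ^ (m %/ 5))).
  exact/leq_expn2r/order_le_cube.
rewrite -expnM; apply: (@leq_trans (p.+1 ^ m.-1)); last exact: leq_expn2r.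
by rewrite leq_pexp2l //; lia.
Qed.

(** The sum is at most [2 * n ^ m]. After division by powers of [S = n * (p + 1)],
    with [a = m %/ 5], the claim becomes
    [2 * n ^ (a + 1) <= (p - 1) * (p + 1) ^ (m - 1 - a)], which follows from
    [2 * n = p * (p - 1)], [n <= (p + 1) ^ 2] and [m - 1 - a >= 2 * a + 1]. *)
Lemma diagonal_pow_bound : 5 <= m ->
  S ^ (m %/ 5) * (size (primes m) + (p.+1 ^ m + n ^ m)) <= p.-1 * S * S ^ (m - 2).
Proof.
move=> m_ge5; set a := m %/ 5.
have a_gt0 : 0 < a by rewrite divn_gt0.
have le_a : 5 * a <= m by rewrite mulnC leq_trunc_div.
have n_ge : 2 * p.+1 <= n.
  have : 11 * p.-1 <= p * p.-1 by rewrite leq_mul2r p_ge11 orbT.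
  lia.
have primes_le : size (primes m) <= p.+1 ^ m.
  have le_m : size (primes m) <= m.
    rewrite -[leqRHS](size_iota 1); apply: uniq_leq_size (primes_uniq m) _ => r.
    rewrite mem_primes mem_iota => /and3P[/prime_gt0 -> m_gt0 /(dvdn_leq m_gt0)].
    by rewrite add1n ltnS.
  apply: leq_trans le_m (ltnW _); apply: ltn_expl; lia.
have sum_le : size (primes m) + (p.+1 ^ m + n ^ m) <= 2 * n ^ m.
  have : (2 * p.+1) ^ m <= n ^ m by rewrite leq_exp2r //; lia.
  have : 2 * p.+1 ^ m <= (2 * p.+1) ^ m.
    by rewrite expnMn leq_mul2r -{1}(expn1 2) leq_pexp2l ?orbT //; lia.
  lia.
apply: (@leq_trans (S ^ a * (2 * n ^ m))); first by rewrite leq_mul2l sum_le orbT.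
have -> : p.-1 * S * S ^ (m - 2) = S ^ a * (p.-1 * S ^ (m - 1 - a)).
  rewrite -mulnA -expnS mulnCA -expnD; congr (_ * S ^ _); lia.
rewrite leq_mul2l; apply/orP; right.
have -> : n ^ m = n ^ (m - 1 - a) * n ^ a.+1 by rewrite -expnD; congr (n ^ _); lia.
rewrite S_eq expnMn mulnCA (mulnCA p.-1) leq_mul2l; apply/orP; right.
have n_le : n <= p.+1 ^ 2.
  have : p * p.-1 <= p.+1 * p.+1 by rewrite leq_mul //; lia.
  by rewrite -mulnn; lia.
rewrite expnSr mulnCA n_eq.
apply: (@leq_trans ((p.+1 ^ 2) ^ a * (p.+1 * p.-1))).
  by apply: leq_mul; [apply: leq_expn2r | rewrite leq_mul2r leqnSn orbT].
rewrite -expnM mulnA -expnSr mulnC leq_mul2l; apply/orP; right.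
by rewrite leq_pexp2l //; lia.
Qed.

End Numerics.

(** * Two by two matrices *)

Section Matrix22.
Import GRing.Theory.
Local Open Scope ring_scope.

Variable F : finFieldType.
Implicit Types a b c d : F.

Definition mx22 a b c d : 'M[F]_2 :=
  \matrix_(i, j) (if i == 0 then if j == 0 then a else b else if j == 0 then c else d).

Lemma mx22P (A B : 'M[F]_2) :
  A 0 0 = B 0 0 -> A 0 1 = B 0 1 -> A 1 0 = B 1 0 -> A 1 1 = B 1 1 -> A = B.
Proof.
have ordP (i : 'I_2) : i = 0 \/ i = 1.
  by case: i => [[|[|i]] Hi] //; [left | right]; apply: val_inj.
move=> E1 E2 E3 E4; apply/matrixP => i j.
by case: (ordP i) => ->; case: (ordP j) => ->.
Qed.

Lemma det22 (A : 'M[F]_2) : \det A = A 0 0 * A 1 1 - A 0 1 * A 1 0.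
Proof.
rewrite (expand_det_row _ 0) !big_ord_recl big_ord0 /cofactor !det_mx11 !mxE /=.
rewrite expr0 expr1 mul1r mulN1r mulrN addr0.
by congr (A _ _ * A _ _ - A _ _ * A _ _); apply: val_inj.
Qed.

Lemma det_mx22 a b c d : \det (mx22 a b c d) = a * d - b * c.
Proof. by rewrite det22 !mxE. Qed.

Lemma mul_mx22 a b c d a' b' c' d' : mx22 a b c d *m mx22 a' b' c' d' =
  mx22 (a * a' + b * c') (a * b' + b * d') (c * a' + d * c') (c * b' + d * d').
Proof.
by apply: mx22P; rewrite !mxE !big_ord_recl big_ord0 !mxE /= addr0.
Qed.

End Matrix22.

(** * Centralizers in SL(2, F) *)

Section SL2Coordinates.
Import GRing.Theory.
Local Open Scope ring_scope.

(* G is any copy of SL(2, F), given by a representation rho. Its elements are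
   written with their four matrix entries by means of sl, so that statements
   about them become polynomial identities. *)
Variables (F : finFieldType) (gT : finGroupType) (G : {group gT}) (rho : gT -> 'M[F]_2).
Hypothesis rhoM : {in G &, {morph rho : u v / (u * v)%g >-> u *m v}}.
Hypothesis rho_inj : {in G &, injective rho}.
Hypothesis rho_det : {in G, forall u, \det (rho u) = 1}.
Hypothesis rho_surj : forall A, \det A = 1 -> exists2 u, u \in G & rho u = A.
Implicit Types (a b c d x y : F) (u v g : gT) (X : {group gT}).

Definition sl a b c d : gT := odflt 1%g [pick u in G | rho u == mx22 a b c d].

Lemma slE a b c d : a * d - b * c = 1 -> sl a b c d \in G /\ rho (sl a b c d) = mx22 a b c d.
Proof.
move=> h; have [|u Gu uA] := @rho_surj (mx22 a b c d); first by rewrite det_mx22.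
rewrite /sl; case: pickP => [v /andP[Gv /eqP] // | /(_ u)].
by rewrite Gu uA eqxx.
Qed.

Lemma sl_in a b c d : a * d - b * c = 1 -> sl a b c d \in G.
Proof. by case/slE. Qed.

Lemma rho_sl a b c d : a * d - b * c = 1 -> rho (sl a b c d) = mx22 a b c d.
Proof. by case/slE. Qed.

Lemma slP u : u \in G -> exists a b c d, a * d - b * c = 1 /\ u = sl a b c d.
Proof.
move=> Gu; exists (rho u 0 0), (rho u 0 1), (rho u 1 0), (rho u 1 1).
have h := rho_det Gu; rewrite det22 in h; split=> //.
apply: rho_inj; rewrite ?sl_in ?rho_sl //.
by apply: mx22P; rewrite !mxE.
Qed.

Lemma sl_inj a b c d a' b' c' d' : a * d - b * c = 1 -> a' * d' - b' * c' = 1 ->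
  sl a b c d = sl a' b' c' d' -> [/\ a = a', b = b', c = c' & d = d'].
Proof.
move=> h h' /(congr1 rho); rewrite !rho_sl // => /matrixP E.
by have := (E 0 0, E 0 1, E 1 0, E 1 1); rewrite !mxE /= => -[[[-> ->] ->] ->].
Qed.

Lemma sl_mul a b c d a' b' c' d' : a * d - b * c = 1 -> a' * d' - b' * c' = 1 ->
  (sl a b c d * sl a' b' c' d')%g =
  sl (a * a' + b * c') (a * b' + b * d') (c * a' + d * c') (c * b' + d * d').
Proof.
move=> h h'; have hh : (a * a' + b * c') * (c * b' + d * d') -
    (a * b' + b * d') * (c * a' + d * c') = 1.
  by transitivity ((a * d - b * c) * (a' * d' - b' * c')); [ring | rewrite h h' mulr1].
apply: rho_inj; rewrite ?groupM ?sl_in //.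
by rewrite rhoM ?sl_in // !rho_sl // mul_mx22.
Qed.

Lemma rho1 : rho 1%g = 1%:M.
Proof.
have u1 : rho 1%g \in unitmx by rewrite unitmxE rho_det ?group1 ?unitr1.
by rewrite -[LHS](mulKmx u1) -rhoM ?group1 // mulg1 mulVmx.
Qed.

Lemma sl1 : sl 1 0 0 1 = 1%g.
Proof.
have h : 1 * 1 - 0 * 0 = 1 :> F by ring.
apply: rho_inj; rewrite ?sl_in ?group1 // rho_sl // rho1.
by apply: mx22P; rewrite !mxE.
Qed.

Definition trSL u : F := \tr (rho u).

Lemma trSL_sl a b c d : a * d - b * c = 1 -> trSL (sl a b c d) = a + d.
Proof. by move=> h; rewrite /trSL rho_sl // /mxtrace !big_ord_recl big_ord0 !mxE addr0. Qed.

Local Notation Z := 'Z(G)%g.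
Local Notation q := #|F|.

Lemma eq_sl a b c d a' b' c' d' : a = a' -> b = b' -> c = c' -> d = d' ->
  sl a b c d = sl a' b' c' d'.
Proof. by move=> -> -> -> ->. Qed.

Local Opaque sl trSL.

Lemma slV a b c d : a * d - b * c = 1 -> ((sl a b c d)^-1)%g = sl d (- b) (- c) a.
Proof.
move=> h; apply/eqP; rewrite eq_invg_mul sl_mul //; last by rewrite -h; ring.
by rewrite -sl1; apply/eqP; apply: eq_sl => //; rewrite -?h; ring.
Qed.

Lemma slJ a b c d a' b' c' d' : a * d - b * c = 1 -> a' * d' - b' * c' = 1 ->
  (sl a b c d ^ sl a' b' c' d')%g =
  sl (d' * (a * a' + b * c') - b' * (c * a' + d * c'))
     (d' * (a * b' + b * d') - b' * (c * b' + d * d'))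
     (a' * (c * a' + d * c') - c' * (a * a' + b * c'))
     (a' * (c * b' + d * d') - c' * (a * b' + b * d')).
Proof.
move=> h h'; rewrite conjgE slV // !sl_mul //; first by apply: eq_sl => //; ring.
- by rewrite -h'; ring.
- by rewrite -[RHS](mulr1 1) -{1}h -h'; ring.
Qed.

(** Two matrices commute when their vectors [(b, c, a - d)] are parallel. *)
Lemma sl_commute a b c d a' b' c' d' : a * d - b * c = 1 -> a' * d' - b' * c' = 1 ->
  commute (sl a b c d) (sl a' b' c' d') <->
  [/\ b * c' = b' * c, b * (a' - d') = b' * (a - d) & c * (a' - d') = c' * (a - d)].
Proof.
move=> h h'; rewrite /commute !sl_mul //; split=> [E | [E1 E2 E3]].
  have [] := sl_inj _ _ E.
  - by rewrite -[RHS](mulr1 1) -{1}h -h'; ring.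
  - by rewrite -[RHS](mulr1 1) -{1}h -h'; ring.
  move=> E1 E2 E3 _; split.
  - by apply: (addrI (a * a')); rewrite E1; ring.
  - by apply/eqP; rewrite -subr_eq0; move/eqP: E2; rewrite -subr_eq0 => /eqP E2;
      apply/eqP; rewrite -oppr0 -E2; ring.
  - by apply/eqP; rewrite -subr_eq0; move/eqP: E3; rewrite -subr_eq0 => /eqP E3;
      apply/eqP; rewrite -E3; ring.
apply: eq_sl => //.
- by rewrite E1; ring.
- by apply/eqP; rewrite -subr_eq0; move/eqP: E2; rewrite -subr_eq0 => /eqP E2;
      apply/eqP; rewrite -oppr0 -E2; ring.
- by apply/eqP; rewrite -subr_eq0; move/eqP: E3; rewrite -subr_eq0 => /eqP E3;
      apply/eqP; rewrite -E3; ring.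
- by rewrite (_ : c * b' = b * c'); [ring | rewrite E1; ring].
Qed.

(** Deduces an equation from another one when [ring] shows that the two
    differences of sides agree. *)
Lemma eq_via (x y x' y' : F) : x' = y' -> x - y = x' - y' -> x = y.
Proof. by move=> ->; rewrite subrr => /eqP; rewrite subr_eq0 => /eqP. Qed.

Lemma sl_centerE a b c d : a * d - b * c = 1 ->
  (sl a b c d \in Z) = [&& b == 0, c == 0 & a == d].
Proof.
move=> h; apply/idP/idP => [/centerP[_ cent] | /and3P[/eqP b0 /eqP c0 /eqP ad]].
  have h1 : 1 * 1 - 1 * 0 = 1 :> F by ring.
  have h2 : 1 * 1 - 0 * 1 = 1 :> F by ring.
  have [_ _ c0] := (sl_commute h h1).1 (cent _ (sl_in h1)).
  have [b0 E _] := (sl_commute h h2).1 (cent _ (sl_in h2)).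
  have [c0' E' _] := (sl_commute h h1).1 (cent _ (sl_in h1)).
  apply/and3P; split; apply/eqP.
  - by apply: (eq_via b0); ring.
  - by apply: esym; apply: (eq_via c0'); ring.
  by apply: esym; apply: (eq_via E'); ring.
apply/centerP; split; first exact: sl_in.
move=> v /slP[a' [b' [c' [d' [h' ->]]]]]; apply/sl_commute => //.
by rewrite b0 c0 ad; split; ring.
Qed.

Lemma parallel_trans (b c e b1 c1 e1 b2 c2 e2 : F) :
  b != 0 -> b * c1 = b1 * c -> b * e1 = b1 * e -> b * c2 = b2 * c -> b * e2 = b2 * e ->
  [/\ b1 * c2 = b2 * c1, b1 * e2 = b2 * e1 & c1 * e2 = c2 * e1].
Proof.
move=> nb Ec1 Ee1 Ec2 Ee2; have nbb : b * b != 0 by rewrite mulf_neq0.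
split.
- by apply: (mulfI nb); transitivity (b1 * (b * c2)); [ring|];
    transitivity (b2 * (b * c1)); [rewrite Ec1 Ec2 |]; ring.
- by apply: (mulfI nb); transitivity (b1 * (b * e2)); [ring|];
    transitivity (b2 * (b * e1)); [rewrite Ee1 Ee2 |]; ring.
by apply: (mulfI nbb); transitivity ((b * c1) * (b * e2)); [ring|];
    transitivity ((b * c2) * (b * e1)); [rewrite Ec1 Ec2 Ee1 Ee2 |]; ring.
Qed.

(** The vector [(b, c, a - d)] of a noncentral [u] is not zero, and those of [v1]
    and [v2] are parallel to it, hence to each other. *)
Lemma SL_cent_abelian u v1 v2 : u \in G -> u \notin Z -> v1 \in G -> v2 \in G ->
  commute u v1 -> commute u v2 -> commute v1 v2.
Proof.
case/slP=> [a [b [c [d [h ->]]]]]; rewrite sl_centerE //.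
move=> nz /slP[a1 [b1 [c1 [d1 [h1 ->]]]]] /slP[a2 [b2 [c2 [d2 [h2 ->]]]]].
move=> /(sl_commute h h1)[E1 E2 E3] /(sl_commute h h2)[E1' E2' E3'].
apply/sl_commute => //; have [b0|nb] := eqVneq b 0.
  have [c0|nc] := eqVneq c 0.
    have ne : a - d != 0 by move: nz; rewrite b0 c0 !eqxx /= subr_eq0.
    have [] := @parallel_trans (a - d) b c (a1 - d1) b1 c1 (a2 - d2) b2 c2 ne.
    - by rewrite [LHS]mulrC -E2; ring.
    - by rewrite [LHS]mulrC -E3; ring.
    - by rewrite [LHS]mulrC -E2'; ring.
    - by rewrite [LHS]mulrC -E3'; ring.
    by move=> F1 F2 F3; split=> //; [rewrite [LHS]mulrC -F1 | rewrite [LHS]mulrC -F2]; ring.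
  have [] := @parallel_trans c b (a - d) c1 b1 (a1 - d1) c2 b2 (a2 - d2) nc.
  - by rewrite [LHS]mulrC -E1; ring.
  - by rewrite E3.
  - by rewrite [LHS]mulrC -E1'; ring.
  - by rewrite E3'.
  by move=> F1 F2 F3; split=> //; rewrite [LHS]mulrC -F1; ring.
by apply: (@parallel_trans b c (a - d) b1 c1 (a1 - d1) b2 c2 (a2 - d2)).
Qed.

(** Hence the centralizers of noncentral elements partition the noncentral
    elements of any subgroup. *)
Lemma SL_cent1_eq X u v : X \subset G -> u \in G -> u \notin Z ->
  v \in G -> v \notin Z -> commute u v -> 'C_X[v]%g = 'C_X[u]%g.
Proof.
move=> sXG Gu nu Gv nv uv; apply/setP => x; rewrite !in_setI.
case: (boolP (x \in X)) => //= Xx; have Gx := subsetP sXG x Xx.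
apply/cent1P/cent1P => E; apply/commute_sym.
  exact: (@SL_cent_abelian v) => //; apply/commute_sym.
exact: (@SL_cent_abelian u).
Qed.

Lemma trSLJ u v : u \in G -> v \in G -> trSL (u ^ v)%g = trSL u.
Proof.
case/slP=> [a [b [c [d [h ->]]]]] /slP[a' [b' [c' [d' [h' ->]]]]].
rewrite slJ // !trSL_sl //; last first.
  by transitivity ((a' * d' - b' * c') * ((a' * d' - b' * c') * (a * d - b * c)));
    [ring | rewrite h h' !mulr1].
by transitivity ((a' * d' - b' * c') * (a + d)); [ring | rewrite h' mul1r].
Qed.

Lemma trSLV u : u \in G -> trSL u^-1%g = trSL u.
Proof.
case/slP=> [a [b [c [d [h ->]]]]]; have h' : d * a - - b * - c = 1 by rewrite -h; ring.
by rewrite slV // (trSL_sl h) (trSL_sl h') addrC.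
Qed.

Hypothesis two_neq0 : 2%:R != 0 :> F.

(** The vectors [(b, c, a - d)] are proportional, say with ratio [k]. Equal traces
    give equal discriminants, so [k ^+ 2 = 1] when the discriminant of [u] is not
    zero, and the two signs correspond to [u] and to its adjugate [u^-1]. *)
Lemma SL_commute_tr u v : u \in G -> u \notin Z -> v \in G -> commute u v ->
  trSL v = trSL u -> trSL u * trSL u != 2%:R * 2%:R -> v = u \/ v = u^-1%g.
Proof.
case/slP=> [a [b [c [d [h ->]]]]]; rewrite sl_centerE // => nz.
case/slP=> [a' [b' [c' [d' [h' ->]]]]] /(sl_commute h h')[E1 E2 E3].
rewrite slV // (trSL_sl h) (trSL_sl h') => Et ss.
pose e := a - d; pose e' := a' - d'; rewrite -/e -/e' in E2 E3.
have disc : e' * e' + 4%:R * (b' * c') = e * e + 4%:R * (b * c).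
  transitivity ((a' + d') * (a' + d') - 4%:R * (a' * d' - b' * c')).
    by rewrite /e'; ring.
  transitivity ((a + d) * (a + d) - 4%:R * (a * d - b * c)); last by rewrite /e; ring.
  by rewrite Et h h'.
have disc0 : e * e + 4%:R * (b * c) != 0.
  apply: contraNneq ss => E; rewrite -subr_eq0; apply/eqP.
  rewrite -[RHS]E -[2%:R * 2%:R]mulr1 -[X in _ - _ * X]h /e; ring.
(* the ratio is read off from any nonzero entry of the vector of u *)
have [k [Eb Ec Ee]] : exists k, [/\ b' = k * b, c' = k * c & e' = k * e].
  have [b0|nb] := eqVneq b 0; last first.
    exists (b' / b); split; first by field.
      by apply: (mulfI nb); rewrite E1; field.
    by apply: (mulfI nb); rewrite E2; field.
  have [c0|nc] := eqVneq c 0; last first.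
    exists (c' / c); split; first by apply: (mulfI nc); rewrite mulrC -E1; field.
      by field.
    by apply: (mulfI nc); rewrite E3; field.
  have ne : e != 0 by move: nz; rewrite b0 c0 !eqxx /= subr_eq0.
  exists (e' / e); split; first by apply: (mulfI ne); rewrite mulrC -E2; field.
    by apply: (mulfI ne); rewrite mulrC -E3; field.
  by field.
have kk : (k - 1) * (k + 1) = 0.
  apply: (mulIf disc0); rewrite mul0r; apply: (eq_via disc).
  by rewrite Eb Ec Ee; ring.
have half x y : 2%:R * x = 2%:R * y -> x = y by move/(mulfI two_neq0).
have ea x y : a' + d' = x + y -> a' - d' = x - y -> a' = x /\ d' = y.
  move=> Es Ed; split; apply: half.
    by transitivity ((a' + d') + (a' - d')); [ring | rewrite Es Ed; ring].
  by transitivity ((a' + d') - (a' - d')); [ring | rewrite Es Ed; ring].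
move/eqP: kk; rewrite mulf_eq0 => /orP[] /eqP Ek; [left | right].
  have k1 : k = 1 by apply: (eq_via Ek); ring.
  have [-> ->] := ea a d Et (etrans Ee (etrans (congr1 (fun z => z * e) k1) (mul1r _))).
  by rewrite Eb Ec k1 !mul1r.
have k1 : k = -1 by apply: (eq_via Ek); ring.
have [-> ->] : a' = d /\ d' = a.
  by apply: ea; [rewrite Et addrC | rewrite -/e' Ee k1 /e; ring].
by rewrite Eb Ec k1 !mulN1r.
Qed.

Local Close Scope ring_scope.

(** * Counting in subgroups without transvections *)

Definition negI : gT := (sl (-1) 0 0 (-1))%R.

Lemma negI_det : ((-1) * (-1) - 0 * 0 = 1 :> F)%R.
Proof. by ring. Qed.

Lemma SL_centerE : Z = [set 1; negI].
Proof.
apply/setP => u; rewrite in_set2; apply/idP/idP => [Zu | /orP[]/eqP->]; last 2 first.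
- exact: group1.
- by rewrite sl_centerE ?negI_det // !eqxx.
have Gu : u \in G by apply: (subsetP (center_sub _)).
have [a [b [c [d [h Du]]]]] := slP Gu; move: Zu; rewrite Du sl_centerE //.
case/and3P => /eqP b0 /eqP c0 /eqP ad; move: h; rewrite b0 c0 -ad mulr0 subr0 => aa.
have : ((a - 1) * (a + 1) = 0)%R by apply: (eq_via aa); ring.
move/eqP; rewrite mulf_eq0 => /orP[] /eqP a1; apply/orP; [left | right].
  have -> : a = 1%R by apply: (eq_via a1); ring.
  by rewrite sl1.
by have -> : a = (-1)%R by apply: (eq_via a1); ring.
Qed.

Lemma negI_neq1 : 1 != negI.
Proof.
rewrite -sl1; apply/eqP => /sl_inj[||E _ _ _]; rewrite ?negI_det //; first by ring.
by case/negP: two_neq0; apply/eqP/(eq_via E); ring.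
Qed.

Lemma card_SL_center : #|Z| = 2.
Proof. by rewrite SL_centerE cards2 negI_neq1. Qed.

(** The possible sizes [B] of a block in a group of order [N], where [A] is the
    order of a centralizer and the alternative is whether its index in its
    normalizer is 1 or 2: [N / 4], then from [N / 3] to below [N / 2], then
    [N / 2], then at least [2 * N / 3]. *)
Lemma partition_arith o A B N :
  (0 < o -> 4 <= A -> ~~ odd A -> B = o * (A - 2) -> N = o * A \/ N = o * (2 * A) ->
  4 * B = N \/ (N <= 3 * B /\ 2 * B < N) \/ 2 * B = N \/ 2 * N <= 3 * B)%N.
Proof.
move=> o_gt0 A4 evA -> ND; have [A_eq | A6] : A = 4 \/ 6 <= A by move: evA A4; lia.
  by subst A; lia.
have : (o * 6 <= o * A)%N by rewrite leq_mul2l A6 orbT.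
rewrite mulnBr; nia.
Qed.

Section Blocks.

Variable X : {group gT}.
Hypotheses (sXG : X \subset G) (sZX : Z \subset X).
Hypothesis ssX : {in X :\: Z, forall u, trSL u * trSL u != 2%:R * 2%:R}%R.

(** The noncentral elements that have a conjugate commuting with [u]. Blocks
    partition the noncentral elements of [X]. *)
Definition block u : {set gT} := class_support ('C_X[u] :\: Z) X.

Lemma block_sub u : block u \subset X :\: Z.
Proof.
rewrite /block class_supportEr; apply/bigcupsP => x Xx; rewrite sub_conjg.
have nZ : (X :\: Z) :^ x^-1 = X :\: Z.
  rewrite conjDg conjGid ?groupV //; congr (_ :\: _); apply/normP.
  rewrite groupV; apply: (subsetP (normal_norm (center_normal G))).
  exact: (subsetP sXG).
by rewrite nZ setSD ?subsetIl.
Qed.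

Lemma center_conj u (x : gT) : x \in X -> (u ^ x \in Z) = (u \in Z).
Proof.
move=> Xx; rewrite memJ_norm //; apply: (subsetP (normal_norm (center_normal G))).
exact: (subsetP sXG).
Qed.

Lemma cent1_block u z : u \in X :\: Z -> z \in 'C_X[u] -> z \notin Z -> 'C_X[z] = 'C_X[u].
Proof.
case/setDP=> Xu nu /setIP[Xz /cent1P zu] nz.
by apply: SL_cent1_eq => //; rewrite ?(subsetP sXG) //.
Qed.

Lemma block_disjoint u v : u \in X :\: Z -> v \in X :\: Z -> v \notin block u ->
  [disjoint block v & block u].
Proof.
move=> Xu Xv; apply: contraR => /pred0Pn[z /andP[/=]].
case/imset2P=> z1 x /setDP[Cz1 nz1] Xx -> /imset2P[z2 y /setDP[Cz2 nz2] Xy E].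
have Xt : y * x^-1 \in X by rewrite groupM ?groupV.
have := cent1_block Xv Cz1 nz1; rewrite -(conjgK x z1) E -conjgM => Ev.
have Eu := cent1_block Xu Cz2 nz2; have [Xv' nv] := setDP Xv.
have : v \in 'C_X[z2 ^ (y * x^-1)] by rewrite Ev in_setI Xv'; apply/cent1P.
rewrite cent1J -{1}(conjGid Xt) -conjIg Eu => Cv.
apply/imset2P; exists (v ^ (y * x^-1)^-1) (y * x^-1) => //.
- by rewrite in_setD center_conj ?groupV // nv -mem_conjg.
by rewrite conjgKV.
Qed.

Lemma center_sub_cent1 u : u \in X -> Z \subset 'C_X[u].
Proof.
move=> Xu; rewrite subsetI sZX; apply: subset_trans (subsetIr _ _) _.
by rewrite -cent_set1 centS // sub1set; apply: (subsetP sXG).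
Qed.

(** Distinct conjugates of the centralizer meet only in the center, so the block
    is a disjoint union of conjugates. *)
Lemma card_block u : u \in X :\: Z ->
  #|block u| = (#|X : 'N_X('C_X[u])| * (#|'C_X[u]| - 2))%N.
Proof.
move=> Xu; have [Xu' nu] := setDP Xu.
have sZC := center_sub_cent1 Xu'.
have TI : normedTI ('C_X[u] :\: Z) X 'N_X('C_X[u]).
  apply/normedTI_P; split.
  - by apply/set0Pn; exists u; rewrite in_setD nu in_setI Xu'; apply/cent1P.
  - rewrite subsetI subsetIl /=; apply/subsetP => x /setIP[Xx /normP nx].
    apply/normP; rewrite conjDg nx; congr (_ :\: _); apply/normP.
    apply: (subsetP (normal_norm (center_normal G))); exact: (subsetP sXG).
  move=> x Xx /pred0Pn[z /andP[/= /setDP[Cz nz]]].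
  rewrite mem_conjg => /setDP[Cz' nz'].
  rewrite in_setI Xx; apply/normP.
  rewrite -{1}(cent1_block Xu Cz' nz') conjIg conjGid // -cent1J conjgKV.
  exact: cent1_block.
rewrite /block (card_support_normedTI TI) cardsD (setIidPr sZC) card_SL_center.
by rewrite mulnC.
Qed.

(** By [SL_commute_tr] the normalizer of the centralizer of [u] moves [u] only to
    [u] or [u^-1]. *)
Lemma card_norm_cent1 u : u \in X :\: Z ->
  #|'N_X('C_X[u])| = #|'C_X[u]| \/ #|'N_X('C_X[u])| = (2 * #|'C_X[u]|)%N.
Proof.
move=> Xu; have [Xu' nu] := setDP Xu; have Gu := subsetP sXG u Xu'.
set N := [group of 'N_X('C_X[u])].
have CN : 'C_N[u] = 'C_X[u].
  by rewrite /N setIAC; apply/setIidPl; apply: normG.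
have orb : u ^: N \subset [set u; u^-1].
  apply/subsetP => _ /imsetP[x /setIP[Xx nx] ->].
  have : u ^ x \in 'C_X[u] by rewrite memJ_norm // in_setI Xu'; apply/cent1P.
  case/setIP=> Xux /cent1P cux; rewrite in_set2.
  have [] := SL_commute_tr Gu nu (subsetP sXG _ Xux) (commute_sym cux) (trSLJ Gu (subsetP sXG x Xx)) (ssX Xu).
    by move=> ->; rewrite eqxx.
  by move=> ->; rewrite eqxx orbT.
have CNc : #|'C_X[u]| = #|'C_N[u]| by rewrite CN.
have LN := Lagrange (subsetIl N 'C[u]); rewrite index_cent1 in LN.
have := etrans (congr1 (fun n => n * #|u ^: N|)%N CNc) LN.
have := subset_leq_card orb; rewrite cards2.
have : 0 < #|u ^: N| by rewrite -index_cent1 indexg_gt0.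
case: #|u ^: N| => [|[|[|n]]] // _ le2 <-; [left | right | by move: le2; case: (u != _)].
  by rewrite muln1.
by rewrite mulnC.
Qed.

Lemma block_type u : u \in X :\: Z ->
  (4 * #|block u| = #|X| \/ (#|X| <= 3 * #|block u| /\ 2 * #|block u| < #|X|) \/
  2 * #|block u| = #|X| \/ 2 * #|X| <= 3 * #|block u|)%N.
Proof.
move=> Xu; have [Xu' nu] := setDP Xu.
apply: (@partition_arith #|X : 'N_X('C_X[u])| #|'C_X[u]|); last 2 first.
- exact: card_block.
- rewrite -(Lagrange (subsetIl X 'N('C_X[u]))) mulnC.
  by case: (card_norm_cent1 Xu) => ->; [left | right].
- exact: indexg_gt0.
- have sZC := center_sub_cent1 Xu'.
  have : #|Z| < #|'C_X[u]|.
    apply: proper_card; apply/properP; split=> //.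
    by exists u => //; rewrite in_setI Xu'; apply/cent1P.
  have := cardSg sZC; rewrite /= card_SL_center; set n := #|'C_X[u]|; move: n; lia.
by have := cardSg (center_sub_cent1 Xu'); rewrite /= card_SL_center dvdn2.
Qed.

(** Unions of blocks, from which blocks can be split off one at a time. *)
Definition saturated (D : {set gT}) :=
  D \subset X :\: Z /\ {in X :\: Z, forall v, v \notin D -> [disjoint block v & D]}.

Lemma saturated_peel D : saturated D -> #|D| < #|X| - 2 ->
  exists2 v, v \in X :\: Z & saturated (D :|: block v) /\
    #|D :|: block v| = (#|D| + #|block v|)%N.
Proof.
case=> sD satD ltD; have cXZ : #|X :\: Z| = (#|X| - 2)%N.
  by rewrite cardsD (setIidPr sZX) card_SL_center.
have [v Xv nDv] : exists2 v, v \in X :\: Z & v \notin D.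
  by apply/subsetPn; apply: contraTN ltD => /subset_leq_card; rewrite cXZ -leqNgt.
exists v => //; split; last first.
  rewrite cardsU (disjoint_setI0 _) ?cards0 ?subn0 //.
  by rewrite disjoint_sym satD.
split; first by rewrite subUset sD block_sub.
move=> w Xw; rewrite in_setU negb_or => /andP[nDw nvw].
by rewrite -setI_eq0 setIUr setU_eq0 !setI_eq0 satD // block_disjoint.
Qed.

(** Dickson's argument. Suppose that the centralizer, of order at least 12, has
    [k > 1] conjugates in [X], of order [N]. If it is self-normalizing, its block
    leaves only [2 * k - 2] noncentral elements, too few for a second block. If
    not, it leaves [N / 2 + 2 * k - 2], where [0 < 2 * k - 2 < N / 12]; by
    [partition_arith] this can only start with two blocks of size [N / 4], and
    the [2 * k - 2] remaining elements are too few for another block. *)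
Lemma norm_large_cent1 u : u \in X :\: Z -> 12 <= #|'C_X[u]| ->
  X \subset 'N('C_X[u]).
Proof.
move=> Xu t12; set k := #|X : 'N_X('C_X[u])|.
have [k1 | k_gt1] := leqP k 1.
  have : X \subset 'N_X('C_X[u]) by rewrite -indexg_eq1 eqn_leq k1 indexg_gt0.
  by rewrite subsetI => /andP[].
have sat1 : saturated (block u).
  by split; [apply: block_sub | move=> v Xv; apply: block_disjoint].
have leX D : saturated D -> #|D| <= #|X| - 2.
  by case=> /subset_leq_card; rewrite cardsD (setIidPr sZX) card_SL_center.
have card1 := card_block Xu; rewrite -/k mulnBr in card1.
have kt : k * 12 <= k * #|'C_X[u]| by rewrite leq_mul2l t12 orbT.
have := Lagrange (subsetIl X 'N('C_X[u])); rewrite -/k mulnC.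
case: (card_norm_cent1 Xu) => -> cardX.
  have [| v Xv [sat2 card2]] := saturated_peel sat1; first by lia.
  have := leX _ sat2; have := block_type Xv; lia.
rewrite mulnCA in cardX.
have [| v Xv [sat2 card2]] := saturated_peel sat1; first by lia.
have le2 := leX _ sat2; have type2 := block_type Xv.
have [| w Xw [sat3 card3]] := saturated_peel sat2; first by lia.
have le3 := leX _ sat3; have type3 := block_type Xw.
have [| x Xx [sat4 card4]] := saturated_peel sat3; first by lia.
have := leX _ sat4; have := block_type Xx; lia.
Qed.

End Blocks.

(** * The unipotent subgroup *)

Local Open Scope ring_scope.

Lemma card_nonzero : #|[set x : F | x != 0]| = q.-1.
Proof. by rewrite -[RHS](cardC1 (0 : F)) cardsE; apply: eq_card => x. Qed.

Lemma q_gt1 : (1 < q)%N.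
Proof. exact: card_finNzRing_gt1. Qed.

Definition ut x : gT := sl 1 x 0 1.
Definition lt x : gT := sl 1 0 x 1.

Lemma ut_det x : 1 * 1 - x * 0 = 1. Proof. by ring. Qed.
Lemma lt_det x : 1 * 1 - 0 * x = 1. Proof. by ring. Qed.

Lemma utD x y : (ut x * ut y)%g = ut (x + y).
Proof. by rewrite /ut sl_mul ?ut_det //; apply: eq_sl => //; ring. Qed.

Definition unip : {set gT} := [set ut x | x : F].

Lemma unip_group_set : group_set unip.
Proof.
apply/group_setP; split; first by apply/imsetP; exists 0 => //; rewrite /ut sl1.
by move=> _ _ /imsetP[x _ ->] /imsetP[y _ ->]; rewrite utD imset_f.
Qed.
Canonical unip_group := Group unip_group_set.

Lemma unip_sub : unip \subset G.
Proof. by apply/subsetP => _ /imsetP[x _ ->]; rewrite sl_in ?ut_det. Qed.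

Lemma mem_unip a b c d : a * d - b * c = 1 ->
  (sl a b c d \in unip) = [&& a == 1, c == 0 & d == 1].
Proof.
move=> h; apply/imsetP/and3P => [[x _ E] | [/eqP-> /eqP-> /eqP->]].
  by have [] := sl_inj h (ut_det x) E => -> _ -> ->.
by exists b.
Qed.

Lemma card_unip : #|unip| = q.
Proof.
rewrite card_imset // => x y E.
by have [] := sl_inj (ut_det x) (ut_det y) E.
Qed.

(** The lower left entry of the conjugate is [- x * c ^+ 2]. *)
Lemma unip_conj_lower a b c d x a' b' d' : a * d - b * c = 1 ->
  a' * d' - b' * 0 = 1 -> (ut x ^ sl a b c d)%g = sl a' b' 0 d' -> x != 0 -> c = 0.
Proof.
move=> h h'; rewrite /ut slJ ?ut_det // => E nx.
set e := a * (0 * a + 1 * c) - c * (1 * a + x * c).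
have e0 : e = 0.
  have hh : (d * (1 * a + x * c) - b * (0 * a + 1 * c)) * (a * (0 * b + 1 * d) - c * (1 * b + x * d))
     - (d * (1 * b + x * d) - b * (0 * b + 1 * d)) * e = 1.
    by transitivity ((a * d - b * c) * (a * d - b * c)); [rewrite /e; ring | rewrite h mulr1].
  by case/(sl_inj hh h'): E.
apply/eqP; have : x * (c * c) == 0 by rewrite -oppr_eq0 -e0 /e; apply/eqP; ring.
by rewrite !mulf_eq0 (negPf nx) /= orbb.
Qed.

Lemma mem_norm_unip a b c d : a * d - b * c = 1 ->
  (sl a b c d \in 'N(unip))%g = (c == 0).
Proof.
move=> h; apply/idP/eqP => [/normP nU | c0].
  have : (ut 1%R ^ sl a b c d)%g \in unip.
    by rewrite -nU memJ_conjg imset_f.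
  case/imsetP => y _ E; exact: (unip_conj_lower h (ut_det y) E (oner_neq0 F)).
apply/normP/eqP; rewrite eqEcard cardJg leqnn andbT.
apply/subsetP => v; rewrite mem_conjg => /imsetP[x _ E].
rewrite -(conjgKV (sl a b c d) v) E /ut slJ ?ut_det // c0 mem_unip; last first.
  by transitivity ((a * d - b * c) * (a * d - b * c)); [rewrite c0; ring | rewrite h mulr1].
have ad : a * d = 1 by apply: (eq_via h); rewrite c0; ring.
by apply/and3P; split; apply/eqP; [rewrite -[RHS]ad | | rewrite -[RHS]ad]; ring.
Qed.

Lemma card_norm_unip : #|'N_G(unip)|%g = (q * q.-1)%N.
Proof.
pose f (t : F * F) := sl t.1 t.2 0 t.1^-1.
have fh (t : F * F) : t.1 != 0 -> t.1 * t.1^-1 - t.2 * 0 = 1.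
  by move=> nt; rewrite divff //; ring.
transitivity #|f @: setX [set x : F | x != 0] [set: F]|; last first.
  rewrite card_in_imset ?cardsX ?card_nonzero ?cardsT 1?mulnC // => -[a b] [c d].
  rewrite !in_setX !inE !andbT => na nc /(sl_inj (fh (a, b) na) (fh (c, d) nc))[].
  by move=> /= -> -> _ _.
apply: eq_card => u; apply/setIP/imsetP => [[/slP[a [b [c [d [h ->]]]]]] | [[a b]]].
  rewrite mem_norm_unip // => /eqP c0; have ad : a * d = 1 by rewrite -h c0; ring.
  have na : a != 0 by apply: contra_eq_neq ad => ->; rewrite mul0r eq_sym oner_neq0.
  exists (a, b); first by rewrite in_setX !inE na.
  by rewrite /f c0 /=; apply: eq_sl => //; apply: (mulfI na); rewrite ad divff.
case/setXP; rewrite inE /= => na _ ->; have /= h := fh (a, b) na.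
by rewrite /f /=; split; [apply: sl_in | rewrite mem_norm_unip].
Qed.

(** Matrices with [c != 0] are determined by [a], [c] and [d]; the others form the
    normalizer of [unip]. *)
Lemma card_SL2 : #|G| = (q * q.-1 * q.+1)%N.
Proof.
rewrite -(cardsID 'N(unip)%g G) card_norm_unip -[q.+1]addn1 mulnDr muln1 addnC; congr addn.
pose f (t : F * F * F) := sl t.1.1 ((t.1.1 * t.1.2 - 1) / t.2) t.2 t.1.2.
have fh (t : F * F * F) : t.2 != 0 ->
    t.1.1 * t.1.2 - ((t.1.1 * t.1.2 - 1) / t.2) * t.2 = 1.
  by move=> nt; rewrite divfK //; ring.
transitivity #|f @: setX [set: F * F] [set x : F | x != 0]|; last first.
  rewrite card_in_imset ?cardsX ?card_nonzero ?cardsT ?card_prod => [|[[a d] c] [[a' d'] c']]; first by rewrite mulnAC.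
  rewrite !in_setX !inE /= => nc nc' /(sl_inj (fh (a, d, c) nc) (fh (a', d', c') nc'))[].
  by move=> /= -> _ -> ->.
apply: eq_card => u; apply/setDP/imsetP => [[/slP[a [b [c [d [h ->]]]]]] | [[[a d] c]]].
  rewrite mem_norm_unip // => nc; exists (a, d, c); first by rewrite in_setX !inE.
  rewrite /f /=; apply: eq_sl => //; apply: (mulIf nc); rewrite divfK //.
  by apply: (eq_via (esym h)); ring.
case/setXP=> _; rewrite inE /= => nc ->; have /= h := fh (a, d, c) nc.
by rewrite /f /=; split; [apply: sl_in | rewrite mem_norm_unip].
Qed.

(** Conjugating the second subgroup by a suitable element of the first turns it
    into the lower unipotent subgroup. A matrix with [c != 0] is a product
    upper, lower, upper, and multiplying by a lower unipotent matrix reduces the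
    other matrices to this case. *)
Lemma unip_conj_gen X a b c d : a * d - b * c = 1 -> c != 0 ->
  unip \subset X -> (unip :^ sl a b c d)%g \subset X -> G \subset X.
Proof.
move=> h nc sU sUg.
have Xut x : ut x \in X by apply: (subsetP sU); rewrite imset_f.
have Xlt z : lt z \in X.
  pose x := - z / (c * c); pose s := d / c.
  have -> : lt z = ((ut x ^ sl a b c d) ^ ut (- s))%g.
    rewrite /ut /lt slJ ?ut_det // slJ ?ut_det //; last first.
      by transitivity ((a * d - b * c) * (a * d - b * c)); [ring | rewrite h mulr1].
    have bE : b = (a * d - 1) / c by apply: (mulIf nc); rewrite divfK // -h; ring.
    by apply: eq_sl => //; rewrite /x /s bE; field.
  by rewrite groupJ //; apply: (subsetP sUg); rewrite memJ_conjg imset_f.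
have lower a' b' c' d' : a' * d' - b' * c' = 1 -> c' != 0 -> sl a' b' c' d' \in X.
  move=> h' nc'.
  have -> : sl a' b' c' d' = (ut ((a' - 1) / c')%R * lt c' * ut ((d' - 1) / c')%R)%g.
    have bE : b' = (a' * d' - 1) / c' by apply: (mulIf nc'); rewrite divfK // -h'; ring.
    rewrite /ut /lt sl_mul ?ut_det ?lt_det // sl_mul ?ut_det //; last by field.
    by apply: eq_sl => //; rewrite ?bE; field.
  by rewrite !groupM.
apply/subsetP => _ /slP[a' [b' [c' [d' [h' ->]]]]].
have [c0 | nc'] := eqVneq c' 0; last exact: lower.
have na : a' != 0.
  by apply: contra_eq_neq h' => ->; rewrite c0 mul0r mulr0 subr0 eq_sym oner_neq0.
rewrite -(mulKg (lt 1) (sl a' b' c' d')) groupM ?groupV //.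
rewrite /lt sl_mul ?lt_det //; apply: lower => //.
  by rewrite c0 -[RHS]h' c0; ring.
by rewrite c0 mul1r mulr0 addr0.
Qed.

Lemma unip_over X : X \proper G -> unip \subset X -> X \subset 'N(unip)%g.
Proof.
move=> prX sU; apply/subsetP => v Xv.
have [a [b [c [d [h Dv]]]]] := slP (subsetP (proper_sub prX) v Xv).
rewrite Dv mem_norm_unip //; apply: contraT => nc; case/negP: (proper_subn prX).
by apply: (unip_conj_gen h nc sU); rewrite -Dv -(conjGid Xv) conjSg.
Qed.

Lemma unip_isolated g : g \in G -> (unip :^ g \subset 'N(unip))%g -> (unip :^ g)%g = unip.
Proof.
case/slP=> [a [b [c [d [h ->]]]]] sN; apply/normP; rewrite mem_norm_unip //.
have : (ut 1%R ^ sl a b c d)%g \in 'N(unip)%g.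
  by apply: (subsetP sN); rewrite memJ_conjg imset_f.
have : (ut 1%R ^ sl a b c d)%g \in G by rewrite groupJ ?sl_in ?ut_det.
case/slP=> [a' [b' [c' [d' [h' E]]]]]; rewrite E mem_norm_unip // => /eqP c0.
rewrite c0 in h' E; apply/eqP; exact: (unip_conj_lower h h' E (oner_neq0 F)).
Qed.

(** An element fixing three different lines is scalar: conjugation by the identity
    gives [c = 0], by the quarter turn [b = 0], and by a lower unipotent matrix
    then [a = d]. *)
Lemma norm_unip_core u : u \in G ->
  (forall g, g \in G -> u ^ g \in 'N(unip))%g -> u \in Z.
Proof.
case/slP=> [a [b [c [d [h ->]]]]] nU.
have lower a' b' c' d' (h' : a' * d' - b' * c' = 1) :
    a' * (c * a' + d * c') - c' * (a * a' + b * c') = 0.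
  have := nU _ (sl_in h'); rewrite slJ // mem_norm_unip; first by move/eqP.
  by transitivity ((a' * d' - b' * c') * ((a' * d' - b' * c') * (a * d - b * c)));
      [ring | rewrite h h' !mulr1].
have c0 : c = 0 by rewrite -[RHS](lower 1 0 0 1 (lt_det 0)); ring.
have hn : 0 * 0 - 1 * (-1) = 1 :> F by ring.
have b0 : b = 0 by apply/eqP; rewrite -oppr_eq0 -(lower _ _ _ _ hn); apply/eqP; ring.
have ad : a = d by apply: (eq_via (esym (lower _ _ _ _ (lt_det 1)))); rewrite b0 c0; ring.
by rewrite sl_centerE // b0 c0 ad !eqxx.
Qed.

(** The diagonal matrix with entries [2] and [1/2] scales [unip] by [1/4], so
    the commutators with it fill [unip] as soon as [3] is invertible. *)
Lemma unip_derived : 3%:R != 0 :> F -> unip \subset [~: G, G]%g.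
Proof.
move=> three_neq0; apply/subsetP => _ /imsetP[x _ ->].
have hd : 2%:R * 2%:R^-1 - 0 * 0 = 1 :> F by rewrite divff //; ring.
pose y := - (2%:R * 2%:R * x) / 3%:R.
pose D : gT := sl 2%:R 0 0 2%:R^-1; have -> : ut x = [~ ut y, D]%g.
  rewrite /D.
  rewrite commgEl /ut slV ?ut_det // slJ ?ut_det // sl_mul.
  - apply: eq_sl => //; try by field; rewrite ?two_neq0.
    by rewrite /y; field; rewrite two_neq0 three_neq0.
  - by ring.
  by field; rewrite ?two_neq0.
by rewrite mem_commg ?sl_in ?ut_det.
Qed.

(** * The nonsplit torus *)

Definition is_square x := [exists y : F, x == y * y].

Lemma nonsquare_exists : exists x, ~~ is_square x.
Proof.
apply/existsP; rewrite -negb_forall; apply/negP => /forallP allsq.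
pose f (y : F) := y * y.
have inj : {in [set: F] &, injective f}.
  apply/imset_injP/eqP; congr #|pred_of_set _|; apply/setP => x; rewrite inE.
  by have /existsP[y /eqP ->] := allsq x; apply: imset_f; rewrite inE.
have E : (1 : F) = -1 by apply: inj; rewrite ?inE // /f; ring.
by case/negP: two_neq0; apply/eqP/(eq_via E); ring.
Qed.

Lemma nonsquare_neq0 x : ~~ is_square x -> x != 0.
Proof. by apply: contraNneq => ->; apply/existsP; exists 0; rewrite mulr0. Qed.

(** The squares have index two: with a nonsquare multiple they already have
    as many elements as all of [F^*]. *)
Lemma nonsquare_ratio x y : ~~ is_square x -> ~~ is_square y -> is_square (x / y).
Proof.
move=> nx ny; have y0 := nonsquare_neq0 ny.
pose nz := [set z : F | z != 0]; pose S := [set z * z | z in nz].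
pose S' := [set y * s | s in S].
have cS : (#|nz| <= #|S| * 2)%N.
  apply: (fiber_bound (f := fun z => z * z)) => [z nzz | _ /imsetP[w _ ->]].
    exact: imset_f.
  apply: (@leq_trans #|[set w; - w]|); last by rewrite cards2; case: (_ != _).
  apply/subset_leq_card/subsetP => z /setIdP[_ /eqP E]; rewrite in_set2.
  have /eqP : (z - w) * (z + w) = 0 by apply: (eq_via E); ring.
  by rewrite mulf_eq0 subr_eq0 addr_eq0.
have sS s : s \in S -> is_square s /\ s != 0.
  case/imsetP=> z; rewrite inE => nzz ->; split; last by rewrite mulf_neq0.
  by apply/existsP; exists z.
have cS' : #|S'| = #|S| by apply: card_imset; apply: mulfI.
have dis : S :&: S' = set0.
  apply/setP => s; rewrite inE in_set0; apply/negP => /andP[/imsetP[z _ ->]].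
  case/imsetP=> _ /imsetP[w] /[!inE] nw -> E; case/negP: ny.
  apply/existsP; exists (z / w); apply/eqP.
  by apply: (mulIf (mulf_neq0 nw nw)); rewrite -E; field.
have full : S :|: S' = nz.
  apply/eqP; rewrite eqEcard cardsU dis cards0 subn0 cS'; apply/andP; split.
    apply/subsetP => s; rewrite !inE => /orP[/sS[] // | /imsetP[t /sS[_ t0] ->]].
    exact: mulf_neq0.
  by rewrite addnn -muln2.
have : x \in S :|: S' by rewrite full inE nonsquare_neq0.
rewrite inE => /orP[/sS[sx _] | /imsetP[s /sS[ss _] ->]]; first by rewrite sx in nx.
by rewrite mulrAC divff // mul1r.
Qed.

(* The excluded value -1 makes the trace of the element tor1 below nonzero. *)
Variable dl : F.
Hypotheses (dl_nsq : ~~ is_square dl) (dl_neqN1 : dl != -1).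

Lemma norm_form_eq0 a b : a * a - dl * (b * b) = 0 -> a = 0 /\ b = 0.
Proof.
move=> /eqP; rewrite subr_eq0 => /eqP E.
have [b0 | nb] := eqVneq b 0.
  by split=> //; apply/eqP; rewrite -(orbb (a == 0)) -mulf_eq0 E b0 !mulr0.
case/negP: dl_nsq; apply/existsP; exists (a / b); apply/eqP.
by apply: (mulIf (mulf_neq0 nb nb)); rewrite -E; field.
Qed.

Lemma norm_form_neq0 a b : (a != 0) || (b != 0) -> a * a - dl * (b * b) != 0.
Proof.
by apply: contraTneq => /norm_form_eq0[-> ->]; rewrite eqxx.
Qed.

Lemma dl_den_neq0 x : 1 - dl * (x * x) != 0.
Proof. by rewrite -[X in X - _]mulr1 norm_form_neq0 // oner_neq0. Qed.

(** The matrix of multiplication by [a + b * sqrt dl] on the quadratic extension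
    of [F]; those of determinant 1 form the nonsplit torus. *)
Definition tor a b : gT := sl a (dl * b) b a.

Lemma tor_det a b : a * a - dl * (b * b) = 1 -> a * a - (dl * b) * b = 1.
Proof. by move=> h; rewrite -mulrA. Qed.

(** The rational parametrization of the conic [a ^+ 2 - dl * b ^+ 2 = 1] by lines
    through [(-1, 0)]. *)
Definition tor_re x := (1 + dl * (x * x)) / (1 - dl * (x * x)).
Definition tor_im x := (2%:R * x) / (1 - dl * (x * x)).

Lemma tor_param x : tor_re x * tor_re x - dl * (tor_im x * tor_im x) = 1.
Proof. by rewrite /tor_re /tor_im; field; apply: dl_den_neq0. Qed.

(** A noncentral element of the torus with nonzero trace; the torus is defined as
    its centralizer. *)
Definition tor1 : gT := tor (tor_re 1) (tor_im 1).

Lemma tor1_det : tor_re 1 * tor_re 1 - (dl * tor_im 1) * tor_im 1 = 1.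
Proof. exact/tor_det/tor_param. Qed.

Lemma tor1_in : tor1 \in G. Proof. exact: sl_in tor1_det. Qed.

Lemma tor_im1_neq0 : tor_im 1 != 0.
Proof. by rewrite mulf_neq0 ?invr_neq0 ?dl_den_neq0 // mulr1. Qed.

Lemma tor1_notin_center : tor1 \notin Z.
Proof. by rewrite sl_centerE ?tor1_det // (negPf tor_im1_neq0) andbF. Qed.

Lemma tor_re1_neq0 : tor_re 1 != 0.
Proof.
rewrite mulf_neq0 ?invr_neq0 ?dl_den_neq0 // !mulr1.
by apply: contraNneq dl_neqN1 => E; apply/eqP/(eq_via E); ring.
Qed.

Lemma trSL_tor1 : trSL tor1 = 2%:R * tor_re 1.
Proof. by rewrite trSL_sl ?tor1_det //; ring. Qed.

Definition torus : {group gT} := [group of 'C_G[tor1]%g].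

Lemma torusP u :
  reflect (exists a b, a * a - dl * (b * b) = 1 /\ u = tor a b) (u \in torus).
Proof.
apply: (iffP setIP) => [[/slP[a [b [c [d [h ->]]]]]] | [a [b [h ->]]]].
  move=> /cent1P/commute_sym/(sl_commute tor1_det h)[E1 E2 E3].
  have nim := tor_im1_neq0.
  have bE : b = dl * c by apply: (mulfI nim); rewrite mulrC -E1; ring.
  have ad : a = d.
    apply/eqP; rewrite -subr_eq0; apply/eqP; apply: (mulfI nim).
    by rewrite E3; ring.
  exists a, c; split; last by rewrite /tor bE ad.
  by rewrite -h -ad bE; ring.
split; first exact: sl_in (tor_det h).
by apply/cent1P/(sl_commute (tor_det h) tor1_det); split; ring.
Qed.

Lemma tor_inj a b a' b' : a * a - dl * (b * b) = 1 -> a' * a' - dl * (b' * b') = 1 ->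
  tor a b = tor a' b' -> a = a' /\ b = b'.
Proof. by move=> /tor_det h /tor_det h' /(sl_inj h h')[]. Qed.

(** The parametrization reaches every point of the conic but [(-1, 0)], and it is
    injective since [x] is recovered as the slope [b / (a + 1)]. *)
Lemma card_torus : #|torus| = q.+1.
Proof.
pose f x := tor (tor_re x) (tor_im x); pose n1 := tor (-1) 0.
have n1h : (-1) * (-1) - dl * (0 * 0) = 1 by ring.
have re1 x : tor_re x + 1 = 2%:R / (1 - dl * (x * x)).
  by rewrite /tor_re; field; apply: dl_den_neq0.
have re1_neq0 x : tor_re x + 1 != 0.
  by rewrite re1 mulf_neq0 ?invr_neq0 ?dl_den_neq0.
have inj : injective f.
  move=> x y /(tor_inj (tor_param x) (tor_param y))[Er Ei].
  have param z : z = tor_im z / (tor_re z + 1).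
    rewrite re1 /tor_im; field; rewrite two_neq0 andbT; exact: dl_den_neq0.
  by rewrite [x]param Er Ei -param.
have -> : torus = n1 |: [set f x | x : F] :> {set gT}.
  apply/setP => u; apply/torusP/setU1P => [[a [b [h ->]]] | [-> | /imsetP[x _ ->]]].
  - have [a1 | na1] := eqVneq (a + 1) 0; [left | right].
      have aN : a = -1 by apply: (eq_via a1); ring.
      have : dl * (b * b) == 0.
        by apply/eqP; apply: (eq_via (esym h)); rewrite aN; ring.
      rewrite !mulf_eq0 orbb => /orP[/eqP d0 | /eqP->]; last by rewrite aN.
      by case/negP: dl_nsq; apply/existsP; exists 0; rewrite d0 mulr0.
    apply/imsetP; exists (b / (a + 1)) => //; rewrite /f.
    have den : 1 - dl * ((b / (a + 1)) * (b / (a + 1))) = 2%:R / (a + 1).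
      have dbb : dl * (b * b) = a * a - 1 by apply: (eq_via (esym h)); ring.
      transitivity ((((a + 1) * (a + 1)) - dl * (b * b)) / ((a + 1) * (a + 1))); first by field.
      by rewrite dbb; field.
    have num : 1 + dl * ((b / (a + 1)) * (b / (a + 1))) = 2%:R * a / (a + 1).
      have dbb : dl * (b * b) = a * a - 1 by apply: (eq_via (esym h)); ring.
      transitivity ((((a + 1) * (a + 1)) + dl * (b * b)) / ((a + 1) * (a + 1))); first by field.
      by rewrite dbb; field.
    have -> : tor_re (b / (a + 1)) = a by rewrite /tor_re den num; field; rewrite na1.
    by have -> : tor_im (b / (a + 1)) = b by rewrite /tor_im den; field; rewrite na1.
  - by exists (-1), 0.
  by exists (tor_re x), (tor_im x); split => //; apply: tor_param.
rewrite cardsU1 card_imset //; case: imsetP => [[x _] | _]; last by rewrite add1n.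
move=> /(tor_inj n1h (tor_param x))[E _]; case/negP: (re1_neq0 x).
by rewrite -E addNr.
Qed.

(** An abelian group of matrices in which [u - 1] is invertible for all [u] other
    than 1 is cyclic; here the determinant of [u - 1] is a value of the
    anisotropic norm form. *)
Lemma torus_cyclic : cyclic torus.
Proof.
have TG : {subset torus <= G} := subsetP (subsetIl _ _).
apply: (@div_ring_mul_group_cyclic _ torus _ rho) => [|u v /TG Gu /TG Gv|u|].
- by rewrite rho1.
- by rewrite rhoM.
- case/setD1P=> nu1 /torusP[a [b [h Du]]].
  rewrite Du rho_sl ?tor_det // -[_ \is a _]/(_ \in unitmx) unitmxE det22 !mxE /= unitfE.
  rewrite (_ : _ - _ = (a - 1) * (a - 1) - dl * (b * b)); last by ring.
  apply: norm_form_neq0; rewrite -negb_and; apply: contra nu1.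
  rewrite subr_eq0 => /andP[/eqP a1 /eqP b0].
  by rewrite Du /tor a1 b0 mulr0 sl1.
apply/centsP => v /setIP[Gv /cent1P cv] w /setIP[Gw /cent1P cw].
by apply: (SL_cent_abelian tor1_in tor1_notin_center); last apply: commute_sym.
Qed.

(** With [c = 0] the eigenvalues would lie in [F], and [dl] would be a square. *)
Lemma torus_trace_lower a b c d : a * d - b * c = 1 ->
  a + d = 2%:R * tor_re 1 -> c != 0.
Proof.
move=> h Et; apply: contra dl_nsq => /eqP c0; apply/existsP.
have nim : 2%:R * tor_im 1 != 0 by rewrite mulf_neq0 ?tor_im1_neq0.
exists ((a - d) / (2%:R * tor_im 1)); apply/eqP; apply: (mulIf (mulf_neq0 nim nim)).
transitivity ((a + d) * (a + d) - 4%:R * (a * d - b * c)); last by rewrite c0; field; rewrite two_neq0 tor_im1_neq0.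
rewrite Et h; apply: (eq_via (esym (congr1 (fun z => 4%:R * z) (tor_param 1)))).
by ring.
Qed.

(** Conjugacy by counting: an element with this trace has [c != 0] and is
    determined by [a] and [c], so there are at most [q * (q - 1)] of them, and
    this is already the size of the conjugacy class of [tor1]. *)
Lemma torus_class v : v \in G -> trSL v = trSL tor1 -> v \in (tor1 ^: G)%g.
Proof.
move=> Gv tv; pose trset := [set v in G | trSL v == trSL tor1].
suff -> : (tor1 ^: G)%g = trset by rewrite in_set Gv tv eqxx.
have q_gt0 : (0 < q)%N := ltnW q_gt1.
apply/eqP; rewrite eqEcard; apply/andP; split.
  apply/subsetP => _ /imsetP[g Gg ->].
  by rewrite inE trSLJ ?tor1_in // eqxx groupJ // tor1_in.
have cardC : #|(tor1 ^: G)%g| = (q * q.-1)%N.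
  rewrite -index_cent1 -divgS ?subsetIl // -/torus card_SL2.
  by rewrite [#|'C_G[tor1]|%g]card_torus mulnK.
rewrite cardC.
pose f (t : F * F) := sl t.1 ((t.1 * (trSL tor1 - t.1) - 1) / t.2) t.2 (trSL tor1 - t.1).
apply: (@leq_trans #|f @: setX [set: F] [set x : F | x != 0]|); last first.
  by apply: leq_trans (leq_imset_card _ _) _; rewrite cardsX cardsT card_nonzero.
apply/subset_leq_card/subsetP => u /setIdP[/slP[a [b [c [d [h ->]]]]]].
rewrite trSL_sl // trSL_tor1 => /eqP Et; have nc := torus_trace_lower h Et.
have dE : d = 2%:R * tor_re 1 - a by rewrite -Et; ring.
apply/imsetP; exists (a, c); first by rewrite in_setX !inE.
rewrite /f /= trSL_tor1 -dE; apply: eq_sl => //; apply: (mulIf nc); rewrite divfK //.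
by apply: (eq_via (esym h)); ring.
Qed.

Lemma tor1_ss : trSL tor1 * trSL tor1 != 2%:R * 2%:R.
Proof.
rewrite trSL_tor1 -subr_eq0.
have -> : 2%:R * tor_re 1 * (2%:R * tor_re 1) - 2%:R * 2%:R =
    dl * ((2%:R * tor_im 1) * (2%:R * tor_im 1)).
  by apply: (eq_via (congr1 (fun z => 4%:R * z) (tor_param 1))); ring.
by do 2?apply: mulf_neq0; rewrite ?(nonsquare_neq0 dl_nsq) // mulf_neq0 ?tor_im1_neq0.
Qed.

Lemma norm_torus_conj (y : gT) : y \in G -> y \in 'N(torus)%g ->
  (tor1 ^ y)%g = tor1 \/ (tor1 ^ y)%g = tor1^-1%g.
Proof.
move=> Gy ny; have : (tor1 ^ y)%g \in torus.
  by rewrite memJ_norm // in_setI tor1_in; apply/cent1P.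
case/setIP=> Gu /cent1P cu.
exact: (SL_commute_tr tor1_in tor1_notin_center Gu (commute_sym cu) (trSLJ tor1_in Gy) tor1_ss).
Qed.

Lemma torusJ g : g \in G -> (torus :^ g = 'C_G[tor1 ^ g])%g.
Proof. by move=> Gg; rewrite /= conjIg conjGid // -cent1J. Qed.

(** The normalizer permutes [tor1] and [tor1^-1], which have the same trace and are
    therefore conjugate. *)
Lemma card_norm_torus : #|'N_G(torus)%g| = (2 * q.+1)%N.
Proof.
set N := [group of 'N_G(torus)%g].
have CN : ('C_N[tor1] = torus :> {set gT})%g.
  by rewrite /N /= setIAC; apply/setIidPl; apply: normG.
have uV : tor1 != tor1^-1%g.
  apply/eqP; rewrite /tor1 /tor slV ?tor1_det // => /sl_inj[||_ _ E _].
  - exact: tor1_det.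
  - by rewrite -[RHS]tor1_det; ring.
  have : 2%:R * tor_im 1 = 0 by apply: (eq_via E); ring.
  by apply/eqP; rewrite mulf_neq0 ?tor_im1_neq0.
have orb : (tor1 ^: N)%g = [set tor1; tor1^-1%g].
  apply/setP => z; rewrite in_set2; apply/imsetP/orP => [[y /setIP[Gy ny] ->] | ].
    by case: (norm_torus_conj Gy ny) => ->; [left | right].
  case=> /eqP->; first by exists 1%g; rewrite ?conjg1.
  have /imsetP[g Gg E] : tor1^-1%g \in (tor1 ^: G)%g.
    by apply: torus_class; rewrite ?groupV ?tor1_in // trSLV ?tor1_in.
  exists g => //; rewrite in_setI Gg; apply/normP; rewrite torusJ // -E /=.
  by rewrite -!cent_cycle cycleV.
have LN := Lagrange (subsetIl N 'C[tor1]%g).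
rewrite index_cent1 orb cards2 uV /= mulnC in LN.
by rewrite -LN; congr muln; rewrite -card_torus; apply/eq_card => z; rewrite -CN.
Qed.

(** An element of the normalizer that inverts [tor1] has trace zero, whereas the
    conjugate of [tor1] by [g] has the trace of [tor1]. So that conjugate
    commutes with [tor1], and has the same centralizer. *)
Lemma torus_isolated g : g \in G -> (torus :^ g \subset 'N(torus))%g ->
  (torus :^ g = torus)%g.
Proof.
move=> Gg sN; rewrite torusJ //; set y := (tor1 ^ g)%g.
have Gy : y \in G by rewrite groupJ ?tor1_in.
have ny : y \in 'N(torus)%g.
  apply: (subsetP sN); rewrite memJ_conjg in_setI tor1_in; exact/cent1P.
have Zy : y \notin Z.
  rewrite memJ_norm ?tor1_notin_center //.
  exact: (subsetP (normal_norm (center_normal G))).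
have [uy | uy] := norm_torus_conj Gy ny.
  apply: SL_cent1_eq => //; rewrite ?tor1_in ?tor1_notin_center //.
  by rewrite /commute -{2}uy conjgE mulKVg.
case/negP: tor_re1_neq0; have : trSL y = 2%:R * tor_re 1 by rewrite trSLJ ?tor1_in // trSL_tor1.
have : (tor1 * y)%g = (y * tor1^-1)%g by rewrite -uy conjgE mulKVg.
have [a [b [c [d [h ->]]]]] := slP Gy; have h0 := tor1_det.
have hV : tor_re 1 * tor_re 1 - - (dl * tor_im 1) * - tor_im 1 = 1.
  by rewrite -[RHS]h0; ring.
rewrite /tor1 /tor slV // !sl_mul // => /sl_inj[].
- by transitivity ((tor_re 1 * tor_re 1 - dl * tor_im 1 * tor_im 1) * (a * d - b * c));
    [ring | rewrite h0 h mulr1].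
- by transitivity ((tor_re 1 * tor_re 1 - dl * tor_im 1 * tor_im 1) * (a * d - b * c));
    [ring | rewrite h0 h mulr1].
move=> _ _ E _; rewrite trSL_sl // => Et.
have : tor_im 1 * (a + d) = 0 by apply: (eq_via E); ring.
rewrite Et => /eqP; rewrite mulf_eq0 (negPf tor_im1_neq0) /=.
by rewrite mulf_eq0 (negPf two_neq0).
Qed.

(** If the discriminant of the characteristic polynomial is a square, there is an
    eigenvector, which a conjugation turns into a coordinate vector. Otherwise
    the discriminant is [dl * e ^+ 2], and the algebra generated by [u] contains
    an element with the trace of [tor1], hence conjugate to it. *)
Lemma SL_conj_cover u : u \in G ->
  exists2 g, g \in G & ((u ^ g)%g \in 'N(unip)%g) || ((u ^ g)%g \in torus).
Proof.
case/slP=> [a [b [c [d [h ->]]]]].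
pose D := (a + d) * (a + d) - 4%:R.
have DE : D = (a - d) * (a - d) + 4%:R * (b * c).
  by apply: (eq_via (congr1 (fun z => 4%:R * z) h)); rewrite /D; ring.
have [/existsP[s /eqP Ds] | nsq] := boolP (is_square D).
  have conj_lower a' b' c' d' (h' : a' * d' - b' * c' = 1) :
      a' * (c * a' + d * c') - c' * (a * a' + b * c') = 0 ->
      exists2 g, g \in G & ((sl a b c d ^ g)%g \in 'N(unip)%g) || ((sl a b c d ^ g)%g \in torus).
    move=> low; exists (sl a' b' c' d'); first exact: sl_in.
    apply/orP; left; rewrite slJ // mem_norm_unip ?low ?eqxx // -low.
    by transitivity ((a' * d' - b' * c') * ((a' * d' - b' * c') * (a * d - b * c)));
      [ring | rewrite h h' !mulr1].
  have [b0 | nb] := eqVneq b 0.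
    have hn : 0 * 0 - 1 * (-1) = 1 :> F by ring.
    by apply: (conj_lower _ _ _ _ hn); rewrite b0; ring.
  apply: (conj_lower _ _ _ _ (lt_det (((d - a) + s) / (2%:R * b)))).
  have ss : s * s = (a - d) * (a - d) + 4%:R * (b * c) by rewrite -Ds.
  have n4 : 4%:R != 0 :> F.
    have -> : 4%:R = 2%:R * 2%:R :> F by ring.
    exact: mulf_neq0.
  have cE : c = (s * s - (a - d) * (a - d)) / (4%:R * b).
    by rewrite ss; field; rewrite ?nb ?n4.
  by rewrite cE; field; rewrite ?nb ?two_neq0 ?n4.
have [e /eqP De] := existsP (nonsquare_ratio nsq dl_nsq).
have D0 := nonsquare_neq0 nsq; have dl0 := nonsquare_neq0 dl_nsq.
have e0 : e != 0.
  by apply: contraNneq (mulf_neq0 D0 (invr_neq0 dl0)) => e0; rewrite De e0 mulr0.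
pose k := tor_im 1 / e.
have kD : k * k * D = dl * (tor_im 1 * tor_im 1).
  have -> : D = e * e * dl by rewrite -De divfK.
  by rewrite /k; field.
have hv : (tor_re 1 + k * (a - d)) * (tor_re 1 - k * (a - d)) -
    (2%:R * k * b) * (2%:R * k * c) = 1.
  transitivity (tor_re 1 * tor_re 1 - k * k * D); first by rewrite DE; ring.
  by rewrite kD tor_param.
have /imsetP[g Gg vE] : sl (tor_re 1 + k * (a - d)) (2%:R * k * b)
    (2%:R * k * c) (tor_re 1 - k * (a - d)) \in (tor1 ^: G)%g.
  by apply: torus_class; rewrite ?sl_in // trSL_sl // trSL_tor1; ring.
exists g^-1%g; rewrite ?groupV //; apply/orP; right.
rewrite -mem_conjgV invgK torusJ // -vE in_setI sl_in //.
by apply/cent1P/(sl_commute h hv); split; ring.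
Qed.



(** * The quotient by the center *)

Section CentralQuotient.

Local Close Scope ring_scope.

Variables (hT : finGroupType) (f : {morphism G >-> hT}).
Hypotheses (ker_f : 'ker f = Z) (im_f : f @* G = [set: hT]).
Hypotheses (q_prime : prime q) (q_ge11 : 11 <= q) (three_neq0 : (3%:R != 0 :> F)%R).

Lemma card_im (A : {group gT}) : Z \subset A -> A \subset G -> (2 * #|f @* A|)%N = #|A|.
Proof.
move=> sZA sAG; rewrite card_morphim (setIidPr sAG) ker_f.
by rewrite -[RHS](Lagrange sZA) card_SL_center.
Qed.

Lemma preim_elt (s : hT) : exists2 u, u \in G & s = f u.
Proof.
have : s \in f @* G by rewrite im_f inE.
by case/morphimP => u Gu _ ->; exists u.
Qed.

Lemma im_subE (A : {set gT}) X : A \subset G -> Z \subset X ->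
  (f @* A \subset f @* X) = (A \subset X).
Proof. by move=> sA sZ; rewrite morphimSGK ?ker_f. Qed.

Lemma center_norm : {in G, forall u, u \in 'N(Z)}.
Proof. exact: (subsetP (normal_norm (center_normal G))). Qed.

Lemma center_sub_torus : Z \subset torus.
Proof. by apply: center_sub_cent1; rewrite ?center_sub ?tor1_in. Qed.

Lemma torus_sub : torus \subset G. Proof. exact: subsetIl. Qed.

Lemma center_sub_norm_unip : Z \subset 'N_G(unip).
Proof.
rewrite subsetI center_sub; apply/subsetP => z Zz; apply: (subsetP (cent_sub _)).
apply/centP => v Uv; case/centerP: Zz => _; apply; exact: (subsetP unip_sub).
Qed.

Lemma center_sub_norm_torus : Z \subset 'N_G(torus).
Proof.
by rewrite subsetI center_sub; apply: subset_trans center_sub_torus (normG _).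
Qed.

Lemma unip_conj_sub g : g \in G -> unip :^ g \subset G.
Proof. by move=> Gg; rewrite -(conjGid Gg) conjSg unip_sub. Qed.

Lemma torus_conj_sub g : g \in G -> torus :^ g \subset G.
Proof. by move=> Gg; rewrite -(conjGid Gg) conjSg torus_sub. Qed.

(** Since the kernel lies in the normalizers, isolation passes to the
    quotient. *)
Lemma im_unipJ_sub g : g \in G -> (f @* unip) :^ f g \subset f @* 'N_G(unip) ->
  unip :^ g = unip.
Proof.
move=> Gg; rewrite -morphimJ // im_subE ?center_sub_norm_unip ?unip_conj_sub //.
by rewrite subsetI => /andP[_]; apply: unip_isolated.
Qed.

Lemma im_torusJ_sub g : g \in G -> (f @* torus) :^ f g \subset f @* 'N_G(torus) ->
  torus :^ g = torus.
Proof.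
move=> Gg; rewrite -morphimJ // im_subE ?center_sub_norm_torus ?torus_conj_sub //.
by rewrite subsetI => /andP[_]; apply: torus_isolated.
Qed.

Lemma norm_im_unip : 'N(f @* unip) = f @* 'N_G(unip).
Proof.
apply/eqP; rewrite eqEsubset; apply/andP; split; last first.
  by rewrite morphim_norms ?subsetIr.
apply/subsetP => s; have [g Gg ->] := preim_elt s => /normP Ns.
rewrite mem_morphim // in_setI Gg; apply/normP; apply: im_unipJ_sub => //.
by rewrite Ns morphimS // subsetI unip_sub normG.
Qed.

Lemma norm_im_torus : 'N(f @* torus) = f @* 'N_G(torus).
Proof.
apply/eqP; rewrite eqEsubset; apply/andP; split; last first.
  by rewrite morphim_norms ?subsetIr.
apply/subsetP => s; have [g Gg ->] := preim_elt s => /normP Ns.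
rewrite mem_morphim // in_setI Gg; apply/normP; apply: im_torusJ_sub => //.
by rewrite Ns morphimS // subsetI torus_sub normG.
Qed.

Lemma card_im_unip : #|f @* unip| = q.
Proof.
rewrite card_morphim (setIidPr unip_sub) ker_f -indexgI coprime_TIg ?indexg1 ?card_unip //.
by rewrite ?card_unip card_SL_center prime_coprime // dvdn_prime2 //; lia.
Qed.

Lemma card_im_torus : (2 * #|f @* torus|)%N = q.+1.
Proof. by rewrite card_im ?center_sub_torus ?torus_sub ?card_torus. Qed.

Lemma card_norm_im_unip : (2 * #|'N(f @* unip)|)%N = (q * q.-1)%N.
Proof. by rewrite norm_im_unip card_im ?center_sub_norm_unip ?subsetIl ?card_norm_unip. Qed.

Lemma card_norm_im_torus : #|'N(f @* torus)| = q.+1.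
Proof.
apply/eqP; rewrite -(eqn_pmul2l (isT : 0 < 2)) norm_im_torus.
by rewrite card_im ?center_sub_norm_torus ?subsetIl ?card_norm_torus.
Qed.

Lemma card_im_SL : (2 * #|hT|)%N = (q * q.-1 * q.+1)%N.
Proof. by rewrite -cardsT -im_f card_im ?center_sub ?card_SL2. Qed.

Lemma card_conjs_norm (A : {group hT}) : (#|A :^: [set: hT]| * #|'N(A)|)%N = #|hT|.
Proof.
by rewrite card_conjugates -[RHS]cardsT -(LagrangeI [set: hT] 'N(A)) setTI mulnC.
Qed.

Lemma card_conjs_unip : #|(f @* unip) :^: [set: hT]| = q.+1.
Proof.
have := card_conjs_norm (f @* unip)%G; have := card_norm_im_unip; have := card_im_SL.
have : 0 < q * q.-1 by rewrite muln_gt0; lia.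
rewrite /=; move: #|hT| #|'N(_)| #|_ :^: _| (q * q.-1)%N q.+1 => a b c d e; nia.
Qed.

Lemma card_conjs_torus : #|(f @* torus) :^: [set: hT]| = (q * q.-1 %/ 2)%N.
Proof.
have := card_conjs_norm (f @* torus)%G; rewrite card_norm_im_torus; have := card_im_SL.
rewrite /=; move: #|hT| #|_ :^: _| (q * q.-1)%N => a b c E1 E2.
have : c = (b * 2)%N by apply/eqP; rewrite -(eqn_pmul2r (ltn0Sn q)) -E1 -E2 mulnCA mulnA.
by move=> ->; rewrite mulnK.
Qed.

Lemma im_unip_indep : ~~ (#|f @* unip| %| #|'N(f @* torus)|).
Proof.
rewrite card_im_unip card_norm_im_torus -addn1 dvdn_addr // dvdn1; lia.
Qed.

(** Modulo [q + 1] the number [q * (q - 1)] is 2. *)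
Lemma im_torus_indep : ~~ (#|f @* torus| %| #|'N(f @* unip)|).
Proof.
apply/negP => dv; have := dvdn_mul (dvdnn 2) dv.
rewrite card_im_torus card_norm_im_unip => {dv} dv.
have E : (q * q.-1 + 2 * q.+1 = q.+1 * q + 2)%N by nia.
have : q.+1 %| q.+1 * q + 2 by rewrite -E dvdn_addr // dvdn_mull.
rewrite dvdn_addr ?dvdn_mulr // => /dvdn_leq; lia.
Qed.

Lemma im_unip_isolated (s : hT) :
  (f @* unip) :^ s \subset 'N(f @* unip) -> (f @* unip) :^ s = f @* unip.
Proof.
have [g Gg ->] := preim_elt s; rewrite norm_im_unip => /(im_unipJ_sub Gg) E.
by rewrite -morphimJ // E.
Qed.

Lemma im_torus_isolated (s : hT) :
  (f @* torus) :^ s \subset 'N(f @* torus) -> (f @* torus) :^ s = f @* torus.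
Proof.
have [g Gg ->] := preim_elt s; rewrite norm_im_torus => /(im_torusJ_sub Gg) E.
by rewrite -morphimJ // E.
Qed.

Lemma im_unip_cyclic : cyclic (f @* unip).
Proof. by apply: prime_cyclic; rewrite card_im_unip. Qed.

Lemma im_torus_cyclic : cyclic (f @* torus).
Proof. exact: morphim_cyclic torus_cyclic. Qed.

Lemma im_cover (s : hT) :
  exists t, (s \in 'N((f @* unip) :^ t)) || (s \in 'N((f @* torus) :^ t)).
Proof.
have [u Gu ->] := preim_elt s; have [g Gg ug] := SL_conj_cover Gu.
exists (f g)^-1; rewrite !normJ !mem_conjgV -morphJ // norm_im_unip norm_im_torus.
have Gug := groupJ Gu Gg; apply/orP; case/orP: ug => ug; [left | right].
  by rewrite mem_morphim // in_setI Gug.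
by rewrite mem_morphim // in_setI Gug (subsetP (normG _)).
Qed.

Lemma proper_preim (P : {group hT}) : P \proper [set: hT] -> f @*^-1 P \proper G.
Proof.
move=> prP; rewrite properE subsetIl; apply: contra (proper_subn prP) => sG.
by rewrite -im_f sub_morphim_pre.
Qed.

Lemma im_preim (P : {group hT}) : f @* (f @*^-1 P) = P.
Proof. by rewrite morphpreK // im_f subsetT. Qed.

Lemma im_unip_over (P : {group hT}) : P \proper [set: hT] -> f @* unip \subset P ->
  P \subset 'N(f @* unip).
Proof.
move=> prP; rewrite sub_morphim_pre ?unip_sub // => sUX.
rewrite -(im_preim P) morphim_norms //.
exact: unip_over (proper_preim prP) sUX.
Qed.

(** A double eigenvalue is 1 or -1, and lies in [F]; up to the sign [z] the element
    is then conjugate to a transvection. *)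
Lemma unipotent_conj u : u \in G -> u \notin Z -> (trSL u * trSL u = 2%:R * 2%:R)%R ->
  exists2 g, g \in G & exists2 z, z \in Z & u ^ g * z \in unip^#.
Proof.
move=> Gu nu tu; have [g Gg ug] := SL_conj_cover Gu; exists g => //.
have Gug : u ^ g \in G by rewrite groupJ.
have nug : u ^ g \notin Z by rewrite memJ_norm ?center_norm.
have tug : (trSL (u ^ g)%g * trSL (u ^ g)%g = 2%:R * 2%:R)%R by rewrite trSLJ.
have [a [b [c [d [h Dv]]]]] := slP Gug.
suff [z Zz Uz] : exists2 z, z \in Z & u ^ g * z \in unip.
  exists z => //; rewrite in_setD1 Uz andbT; apply: contra nug => /eqP E.
  by rewrite -(groupMr _ Zz) E group1.
rewrite Dv in ug nug tug *; rewrite trSL_sl // in tug; rewrite sl_centerE // in nug.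
have disc : ((a - d) * (a - d) + 4%:R * (b * c) = 0)%R.
  transitivity ((a + d) * (a + d) - 4%:R * (a * d - b * c))%R; first by ring.
  by rewrite tug h; ring.
have n4 : (4%:R != 0 :> F)%R.
  have -> : (4%:R = 2%:R * 2%:R :> F)%R by ring.
  by rewrite mulf_neq0.
case/orP: ug => [|/torusP[a' [b' [h' E]]]]; last first.
  have [ea eb ec ed] := sl_inj h (tor_det h') E.
  have : (dl * (b' * b') == 0)%R.
    by apply/eqP/(mulfI n4); rewrite mulr0 -[RHS]disc ea eb ec ed; ring.
  rewrite !mulf_eq0 (negPf (nonsquare_neq0 dl_nsq)) orbb /= => /eqP b0.
  by rewrite ea eb ec ed b0 mulr0 !eqxx in nug.
rewrite mem_norm_unip // => /eqP c0.
have ad : a = d.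
  apply/eqP; rewrite -subr_eq0 -[(_ == _)%R]orbb -mulf_eq0.
  by apply/eqP; rewrite -[RHS]disc c0; ring.
have : ((a - 1) * (a + 1) == 0)%R.
  by apply/eqP; apply: (eq_via h); rewrite c0 ad; ring.
rewrite mulf_eq0 => /orP[] /eqP a1.
  have {}a1 : a = 1%R by apply: (eq_via a1); ring.
  by exists 1; rewrite ?group1 // mulg1 mem_unip // -ad a1 c0 !eqxx.
have {}a1 : a = (-1)%R by apply: (eq_via a1); ring.
exists negI; first by rewrite sl_centerE ?negI_det // !eqxx.
rewrite /negI sl_mul ?negI_det // mem_unip; last first.
  by rewrite -ad a1 c0; ring.
by rewrite -ad a1 c0; apply/and3P; split; apply/eqP; ring.
Qed.

(** Let [X] be the preimage of [P]. If some noncentral element of [X] has a double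
    eigenvalue, then [X] contains, up to conjugation, all of [unip] because its
    order is prime; so [X] normalizes it, which the order of the torus
    prevents. Otherwise [norm_large_cent1] applies to [X]. *)
Lemma im_torus_over (P : {group hT}) : P \proper [set: hT] -> f @* torus \subset P ->
  P \subset 'N(f @* torus).
Proof.
move=> prP; rewrite sub_morphim_pre ?torus_sub // => sTX.
have prX := proper_preim prP; rewrite -(im_preim P) morphim_norms //.
set X := (f @*^-1 P)%G in sTX prX *; have sXG := proper_sub prX.
have sZX := subset_trans center_sub_torus sTX.
have Xtor1 : tor1 \in X by apply: (subsetP sTX); rewrite in_setI tor1_in; apply/cent1P.
have CX : 'C_X[tor1] = torus.
  apply/eqP; rewrite eqEsubset setSI //= subsetI sTX subsetIr //.
have [ss | ] := boolP [forall u in X :\: Z, (trSL u * trSL u != 2%:R * 2%:R)%R].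
  rewrite -CX; apply: norm_large_cent1 => //.
  - exact/forall_inP.
  - by rewrite in_setD tor1_notin_center.
  by rewrite CX card_torus; lia.
rewrite negb_forall_in => /exists_inP[u /setDP[Xu nu]]; rewrite negbK => /eqP tu.
have Gu := subsetP sXG u Xu; have [g Gg [z Zz /setD1P[n1 Uv]]] := unipotent_conj Gu nu tu.
set v := u ^ g * z in n1 Uv.
have sUX : unip \subset X :^ g.
  have Dv : <[v]> = unip.
    apply/eqP; rewrite eqEcard cycle_subG Uv card_unip -orderE /=.
    have /primeP[_ q_div] := q_prime; have := order_dvdG Uv; rewrite card_unip.
    by move/q_div; rewrite order_eq1 (negPf n1) => /eqP ->.
  rewrite -Dv cycle_subG groupM ?memJ_conjg //.
  by rewrite -(normP (center_norm Gg)) in Zz; apply: (subsetP _ _ Zz); rewrite conjSg.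
have prXg : X :^ g \proper G.
  by rewrite properEcard cardJg -(conjGid Gg) conjSg sXG /= cardJg proper_card.
have sTN : torus :^ g \subset 'N_G(unip).
  rewrite subsetI torus_conj_sub //; apply: subset_trans (unip_over prXg sUX).
  by rewrite conjSg.
have := cardSg sTN; rewrite cardJg card_torus card_norm_unip => dv.
case/negP: im_torus_indep; rewrite -(dvdn_pmul2l (isT : 0 < 2)).
by rewrite card_im_torus card_norm_im_unip.
Qed.

(** A normal subgroup that normalizes one Sylow subgroup normalizes all of
    them. *)
Lemma im_core (N : {group hT}) : N <| [set: hT] -> N \subset 'N(f @* unip) -> N :=: 1.
Proof.
move=> nN sN; apply/trivgP/subsetP => s Ns; have [u Gu Ds] := preim_elt s.
suff Zu : u \in Z by rewrite Ds inE; apply/eqP/mker; rewrite ker_f.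
apply: norm_unip_core => // g Gg.
have : f (u ^ g) \in f @* 'N_G(unip).
  rewrite -norm_im_unip; apply: (subsetP sN); rewrite morphJ // -Ds memJ_norm //.
  by apply: (subsetP (normal_norm nN)); rewrite inE.
have Gug := groupJ Gu Gg; have sug : [set u ^ g] \subset G by rewrite sub1set.
rewrite -sub1set -morphim_set1 // (im_subE sug center_sub_norm_unip) sub1set.
by case/setIP.
Qed.

(** The derived subgroup contains the Sylow subgroup, so if it were proper it would
    normalize it, against [im_core]. *)
Lemma im_derived : [~: [set: hT], [set: hT]] = [set: hT].
Proof.
apply/eqP; rewrite -subTset; apply: contraT => nsub.
pose D := [group of [~: [set: hT], [set: hT]]].
have prD : D \proper [set: hT] by rewrite properE subsetT.
have sUD : f @* unip \subset D.
  by rewrite /= -im_f -morphimR // morphimS // unip_derived.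
have D1 := im_core (der_normal 1 _) (im_unip_over prD sUD).
have := subset_leq_card sUD; rewrite D1 cards1 card_im_unip leqNgt.
by rewrite prime_gt1.
Qed.

Lemma im_nonabelian : ~~ abelian [set: hT].
Proof.
apply/negP => ab; have /commG1P E := ab; have := im_derived; rewrite E => T1.
have := subset_leq_card (subsetT (f @* unip)); rewrite -T1 cards1 card_im_unip.
by rewrite leqNgt prime_gt1.
Qed.

(** Iwasawa's argument: either [N] and the cyclic Sylow subgroup generate the
    whole perfect group, whose quotient by [N] is then abelian, or [N] normalizes
    the Sylow subgroup and is trivial. *)
Lemma im_simple : simple [set: hT].
Proof.
apply/simpleP; split=> [|N nN].
  by apply: contra im_nonabelian => /eqP ->; apply: abelian1.
have [full | prP] := eqVproper (subsetT (N <*> (f @* unip))); last first.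
  left; apply: im_core => //.
  apply: subset_trans (joing_subl _ (f @* unip)) _.
  exact: (im_unip_over (P := (N <*> (f @* unip))%G) prP (joing_subr _ _)).
have sN : [~: [set: hT], [set: hT]] \subset N.
  apply: der1_min (normal_norm nN) _.
  have nU : f @* unip \subset 'N(N).
    by apply: subset_trans (subsetT _) (normal_norm nN).
  have ab : abelian ((N <*> (f @* unip)) / N).
    by rewrite quotientYidl // quotient_abelian ?cyclic_abelian ?im_unip_cyclic.
  by rewrite full in ab.
by rewrite im_derived in sN; right; apply/eqP; rewrite eqEsubset subsetT.
Qed.

Definition unip_or_torus (b : bool) : {group hT} :=
  if b then (f @* unip_group)%G else (f @* torus)%G.

Theorem sigma_cyc_wreath_quotient m : 0 < m ->
    (forall r, prime r -> r %| m -> 5 <= r) ->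
  sigma [set: cyc_wreath hT m]%G =
    size (primes m) + (q.+1 ^ m + (q * q.-1 %/ 2) ^ m).
Proof.
move=> m_gt0 m_primes; set n := (q * q.-1 %/ 2)%N.
have n_eq : (2 * n = q * q.-1)%N by rewrite /n -card_norm_im_unip mulKn.
have S_eq : #|hT| = (n * q.+1)%N.
  apply/eqP; rewrite -(eqn_pmul2l (isT : 0 < 2)) card_im_SL -n_eq; apply/eqP; lia.
have norm_unip : #|'N(f @* unip)| = n.
  by apply/eqP; rewrite -(eqn_pmul2l (isT : 0 < 2)) card_norm_im_unip n_eq.
have n_ge : q.+1 <= n.
  have : (11 * q.-1 <= q * q.-1)%N by rewrite leq_mul2r q_ge11 orbT.
  by rewrite -n_eq; lia.
have sumE : \sum_b #|unip_or_torus b :^: [set: hT]| ^ m = (q.+1 ^ m + n ^ m)%N.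
  by rewrite big_bool /= card_conjs_unip card_conjs_torus.
rewrite -sumE.
apply: (@sigma_cyc_wreath hT m bool unip_or_torus im_simple im_nonabelian m_gt0 m_primes
          _ _ _ _ _ _ true false) => //.
- by case; [apply: im_unip_cyclic | apply: im_torus_cyclic].
- move=> s; have [t /orP[] st] := im_cover s; first by exists true, t.
  by exists false, t.
- by case=> P prP; [apply: im_unip_over | apply: im_torus_over].
- by case=> -[] // _; [apply: im_unip_indep | apply: im_torus_indep].
- by case=> s; [apply: im_unip_isolated | apply: im_torus_isolated].
- move=> b; apply: (norm_pow_bound q_ge11 n_eq S_eq _ m_gt0).
  by case: b => /=; [rewrite norm_unip | rewrite card_norm_im_torus].
move=> m_gt1; rewrite sumE.
have m_ge5 : 5 <= m.
  apply: leq_trans (pdiv_leq m_gt0); apply: m_primes (pdiv_prime m_gt1) (pdiv_dvd m).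
apply: leq_trans (diagonal_pow_bound q_ge11 n_eq S_eq m_ge5) _.
rewrite leq_mul2r; apply/orP; right.
rewrite /= card_conjs_unip card_conjs_torus card_im_unip totient_prime // -/n.
have : 0 < totient #|f @* torus| by rewrite totient_gt0 cardG_gt0.
rewrite S_eq; move: (totient _) => k k_gt0.
have -> : (q.-1 * (n * q.+1) = q.+1 * q.-1 * n)%N.
  by rewrite mulnCA [RHS]mulnC (mulnC q.-1).
by rewrite leq_mul2l leq_pmulr ?orbT.
Qed.

End CentralQuotient.

End SL2Coordinates.

(** * The group PSL(2, F) *)

Section PSLInstance.
Import GRing.Theory.

Variable F : finFieldType.
Hypothesis two_neq0 : (2%:R != 0 :> F)%R.
Local Notation G := (SL_group 2 F).
Local Notation Z := 'Z(SL 2 F).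
Local Notation hT := [subg PSL_group 2 F]%type.

Lemma GLval_morph : {in G &, {morph (@GLval 2 F) : u v / u * v >-> (u *m v)%R}}.
Proof. by move=> u v _ _; rewrite GL_MxE. Qed.

Lemma GLval_injective : {in G &, injective (@GLval 2 F)}.
Proof. by move=> u v _ _; apply: val_inj. Qed.

Lemma GLval_det : {in G, forall u, \det (GLval u) = 1}%R.
Proof. by move=> u; rewrite inE => /eqP. Qed.

Lemma GLval_surj (A : 'M[F]_2) : (\det A = 1)%R -> exists2 u, u \in G & GLval u = A.
Proof.
move=> detA; have uA : A \in unitmx by rewrite unitmxE detA unitr1.
have E : GLval (insubd (1 : {'GL_2[F]}) A) = A by rewrite val_insubd uA.
by exists (insubd (1 : {'GL_2[F]}) A) => //; rewrite inE E detA.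
Qed.

Definition psl_map (u : {'GL_2[F]}) : hT := subg (PSL_group 2 F) (coset Z u).

Lemma SL_norm_center : G \subset 'N(Z).
Proof. exact: normal_norm (center_normal G). Qed.

Lemma psl_mapM : {in G &, {morph psl_map : u v / u * v}}.
Proof.
move=> u v Gu Gv; rewrite /psl_map morphM ?(subsetP SL_norm_center) //.
by rewrite subgM //; apply: mem_quotient.
Qed.
Canonical psl_morphism := Morphism psl_mapM.

Lemma ker_psl : 'ker psl_map = Z.
Proof.
apply/setP => u; apply/idP/idP => [ku | Zu].
  have Gu : u \in G := dom_ker ku.
  apply: coset_idr; first exact: (subsetP SL_norm_center).
  have /(congr1 (@sgval _ _)) := mker ku.
  by rewrite /psl_map /= subgK //; apply: mem_quotient.
have Gu : u \in G := subsetP (center_sub G) u Zu.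
by apply/kerP => //=; rewrite /psl_map coset_id // morph1.
Qed.

Lemma im_psl : psl_map @* G = [set: hT].
Proof.
apply/eqP; rewrite -subTset; apply/subsetP => s _.
have /morphimP[u _ Gu E] : sgval s \in PSL_group 2 F := valP s.
by rewrite -(sgvalK s) E; apply: (mem_morphim psl_morphism).
Qed.

(** If the nonsquare found is -1, then -4 is another one. *)
Lemma nonsquare_neqN1 : (3%:R != 0 :> F)%R ->
  exists2 d : F, ~~ is_square d & (d != -1)%R.
Proof.
move=> three_neq0; have [d nd] := nonsquare_exists two_neq0.
have [d1 | ] := eqVneq d (-1)%R; last by exists d.
exists (2%:R * 2%:R * d)%R; last first.
  apply: contraNneq three_neq0 => E; rewrite -oppr_eq0; apply/eqP.
  by apply: (eq_via E); rewrite d1; ring.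
apply: contra nd => /existsP[y /eqP E]; apply/existsP; exists (y / 2%:R)%R.
apply/eqP; apply: (mulfI (mulf_neq0 two_neq0 two_neq0)); rewrite E; field.
exact: two_neq0.
Qed.

End PSLInstance.

Theorem corollary1p3 (p m : nat) (p_prime : prime p) (p_ge11 : 11 <= p)
    (m_gt0 : 0 < m) (m_primes : forall q : nat, prime q -> q %| m -> 5 <= q) :
  sigma [set: cyc_wreath [subg PSL_group 2 'F_p]%type m]%G
  = size (primes m) + (p + 1) ^ m + (p * (p - 1) %/ 2) ^ m.
Proof.
have cardF : #|'F_p| = p := card_Fp p_prime.
have nat_neq0 k : 0 < k < p -> (k%:R != 0 :> 'F_p)%R.
  case/andP=> k_gt0 lt_kp; rewrite -(GRing.dvdn_pcharf (pchar_Fp p_prime)).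
  by apply: contraL lt_kp => /(dvdn_leq k_gt0); rewrite leqNgt.
have two_neq0 : (2%:R != 0 :> 'F_p)%R by apply: nat_neq0; lia.
have three_neq0 : (3%:R != 0 :> 'F_p)%R by apply: nat_neq0; lia.
have [d nd dN1] := nonsquare_neqN1 two_neq0 three_neq0.
have := sigma_cyc_wreath_quotient (@GLval_morph 'F_p) (@GLval_injective 'F_p)
  (@GLval_det 'F_p) (@GLval_surj 'F_p) two_neq0 nd dN1
  (@ker_psl 'F_p) (@im_psl 'F_p).
rewrite cardF => /(_ p_prime p_ge11 three_neq0 m m_gt0 m_primes) ->.
by rewrite addnA addn1 subn1.
Qed.
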